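(* Let $d\ge 1$, let $K\subset\mathbb R^d$ be a compact set equipped with a $\delta$-Ahlfors regular probability measure $\mu$, and let $\boldsymbol\theta\in\mathbb R^d$, $0<\beta<1$ and $\alpha$ with $\frac1d<\alpha<\frac{1+\delta-\beta\delta}{d-\delta}$. Suppose that $\mu$ satisfies the $(\alpha,\beta,\boldsymbol\theta)$-local counting property. Let $\psi:\mathbb N\to\mathbb R_+$ be a monotonic function. If $1/d<\tau(\psi)<\alpha$, then \[\dim_H\big(K\cap W_d(\psi,\boldsymbol\theta)\big)\le \delta+\frac{d+1}{1+\tau(\psi)}-d\] and \[\dim_H\big(K\cap W_d(\psi,\boldsymbol\theta)\big)\ge \min\Big\{\delta-\frac{(\tau(\psi)d-1)\big(\delta+\frac{1+d}{1+\tau(\psi)}-d\big)}{\beta\delta},\ \delta+\frac{1+d}{1+\tau(\psi)}-d\Big\}.\] Moreover, suppose $\delta>d-1$, $\boldsymbol\theta=\mathbf 0$, and there are constants $c>0$ and $\tau$ with $1/d<\tau<\min\{\alpha,\frac{\delta+2-d}{2d-\delta-1}\}$ such that $\psi(q)\ge cq^{-\tau}$ for infinitely many $q$. Then $\mathcal H^s\big(K\cap W_d(\psi,\mathbf 0)\big)=\infty$, where \[s=\min\Big\{\delta-\frac{(\tau-\frac1d)(2d-\delta-1)\big(\delta+\frac{1+d}{1+\tau}-d\big)}{\beta\delta},\ \delta+\frac{1+d}{1+\tau}-d\Big\};\] in particular $s$ is a lower bound for $\dim_H(K\cap W_d(\psi,\mathbf 0))$.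
   Context: For $\mathbf x\in\mathbb R^d$, $|\mathbf x|$ is the supremum norm and $\|\mathbf x\|$ denotes the (sup-norm) distance from $\mathbf x$ to the nearest point of $\mathbb Z^d$; $|E|$ is the diameter of a set $E$, and $\mathcal H^s$, $\dim_H$ denote Hausdorff measure and dimension. For $\psi:\mathbb N\to\mathbb R_+$ and $\boldsymbol\theta\in\mathbb R^d$, $W_d(\psi,\boldsymbol\theta)=\{\mathbf x\in\mathbb R^d:\|q\mathbf x-\boldsymbol\theta\|<\psi(q)\text{ for infinitely many }q\in\mathbb Z\}$. The lower order of $\psi$ is $\tau(\psi)=\liminf_{q\to\infty}\frac{-\log\psi(q)}{\log q}$. A probability measure $\mu$ on a compact set $K$ is $\delta$-Ahlfors regular ($\delta>0$) if there is $C\ge1$ with $C^{-1}r^\delta\le\mu(B(\mathbf x,r))\le Cr^\delta$ for all $\mathbf x\in K$ and $0<r<|K|$. For $Q>1$, $\eta>0$, $A_Q(\eta,\boldsymbol\theta)=\{\mathbf x\in\mathbb R^d:\|q\mathbf x-\boldsymbol\theta\|<\eta\text{ for some integer }Q\le q<2Q\}$. For $\alpha>1/d$, $\beta>0$, $\mu$ satisfies the $(\alpha,\beta,\boldsymbol\theta)$-local counting property if there exist $Q_0$ (depending only on $\alpha,\beta$) and $C\ge 1$ such that for all $Q\ge Q_0$, all $Q^{-\alpha}\le\eta\le Q^{-1/d}$, and all balls $B$ with centre in the support of $\mu$ and $|B|\ge Q^{-\beta}$, one has $C^{-1}\mu(B)Q\eta^d\le\mu(B\cap A_Q(\eta,\boldsymbol\theta))\le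 C\mu(B)Q\eta^d$. *)

(* Defs.v *)
From HB Require Import structures.
From mathcomp Require Import all_boot all_order all_algebra.
From mathcomp Require Import all_classical all_reals all_analysis.
Import Order.TTheory GRing.Theory Num.Theory.
Import numFieldNormedType.Exports.

Set Implicit Arguments.
Unset Strict Implicit.
Unset Printing Implicit Defensive.

Local Open Scope classical_set_scope.
Local Open Scope ring_scope.

(* R^d is 'rV[R]_d, whose library norm `|x| is the sup norm. *)
Notation borel_rV R d := (g_sigma_algebraType (@open 'rV[R]_d)).

Section hausdorff.
Context {R : realType} {V : normedModType R}.
Implicit Types (A : set V) (s rho : R).
Local Open Scope ereal_scope.

(* The added 0 only matters for the empty set, whose supremum would be -oo. *)
Definition diam A : \bar R :=
  ereal_sup ([set 0] `|` [set (`|x - y|%R)%:E | x in A & y in A]).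

(* |A|^s, with 0^0 = 1; the library's [poweR] sends 0 to 0 when the exponent is
   negative, whereas here 0^s = +oo for s < 0. The empty set has weight 0, also
   for s = 0, so that the 0-dimensional Hausdorff measure counts points. *)
Definition diam_pow s A : \bar R :=
  if A == set0 then 0
  else if (s < 0)%R then (diam A `^ (- s)%R)^-1 else diam A `^ s.

(* Finite covers are covers by sequences that are eventually set0. *)
Definition hausdorff_premeasure s rho A : \bar R :=
  ereal_inf [set \sum_(0 <= i <oo) diam_pow s (U i) | U in
    [set U : nat -> set V |
      A `<=` \bigcup_i U i /\ forall i, diam (U i) <= rho%:E]].

(* The limit as rho -> 0+ is a supremum, the premeasure increasing as rho
   decreases. *)
Definition hausdorff_measure s A : \bar R :=
  ereal_sup [set hausdorff_premeasure s rho A | rho in [set rho | (0 < rho)%R]].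

Definition hausdorff_dim A : \bar R :=
  ereal_inf [set s%:E | s in
    [set s : R | (0 <= s)%R /\ hausdorff_measure s A = 0]].

End hausdorff.

Section approximation.
Context {R : realType} {d : nat}.
Implicit Types (x theta : 'rV[R]_d) (psi : nat -> R) (Q eta : R).

Definition dist_int x : R :=
  inf [set `|x - map_mx intr z| | z in [set: 'rV[int]_d]].

(* As psi is a function on the natural numbers, so are the denominators q. *)
Definition W psi theta : set 'rV[R]_d :=
  [set x | infinite_set [set q : nat | dist_int (q%:R *: x - theta) < psi q]].

Definition A_ Q eta theta : set 'rV[R]_d :=
  [set x | exists q : nat,
    Q <= q%:R < 2 * Q /\ dist_int (q%:R *: x - theta) < eta].

End approximation.

(* In the extended reals - lne 0 = +oo, so psi may vanish. *)
Definition lower_order {R : realType} (psi : nat -> R) : \bar R :=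
  limn_einf (fun q => - lne (psi q)%:E / lne (q%:R)%:E)%E.

Section measures.
Context {R : realType} {d : nat}.
Implicit Types (mu : probability (borel_rV R d) R) (K : set 'rV[R]_d).

Definition supp mu : set 'rV[R]_d :=
  [set x | forall r : R, 0 < r -> (0 < mu (ball x r))%E].

Definition ahlfors_regular K mu (delta : R) : Prop :=
  exists2 C : R, 1 <= C &
    forall (x : 'rV[R]_d) (r : R), K x -> 0 < r -> (r%:E < diam K)%E ->
      ((C^-1 * r `^ delta)%:E <= mu (ball x r) <= (C * r `^ delta)%:E)%E.

Definition local_counting mu (alpha beta : R) (theta : 'rV[R]_d) : Prop :=
  exists Q0 C : R, [/\ 1 < Q0, 1 <= C &
    forall (Q eta : R) (x : 'rV[R]_d) (r : R),
      Q0 <= Q ->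
      Q `^ (- alpha) <= eta <= Q `^ (- d%:R^-1) ->
      supp mu x -> 0 < r -> ((Q `^ (- beta))%:E <= diam (ball x r))%E ->
      ((C^-1)%:E * mu (ball x r) * (Q * eta ^+ d)%:E
         <= mu (ball x r `&` A_ Q eta theta)
         <= C%:E * mu (ball x r) * (Q * eta ^+ d)%:E)%E].

End measures.

(* Main.v *)
Require Import Defs.
From mathcomp Require Import all_boot all_order all_algebra.
From mathcomp Require Import all_classical all_reals all_analysis.
From mathcomp Require Import measurable_realfun ring lra.
Import Order.TTheory GRing.Theory Num.Theory.
Import numFieldNormedType.Exports.
Local Open Scope classical_set_scope.
Local Open Scope ring_scope.

(** Proof idea.
    Upper bound: by the counting property, [K `&` A_ Q eta theta] is covered by
    [O(Q * eta ^ d * (eta / Q) ^ (- delta))] balls of radius [eta / Q]; sum over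
    dyadic [Q] with [eta = Q ^ (- t)], [t < tau].
    Lower bounds: given a cover [U] of [K `&` W psi theta] of finite [s]-weight
    by small sets, a point of this set outside all the [U i] is produced.  In a
    ball where the sets [U i] are sparse with respect to [delta]-weights, a
    first moment computation for [mu] restricted to [A_ Q eta theta], with [Q]
    so large that the [U i] of size less than [Q ^ (- beta)] have negligible
    total [s]-weight, yields a much smaller ball inside the approximation set
    where the [U i] are equally sparse.  All that is needed is
    [mu (ball x r `&` A_ Q eta theta) <= C * Q * eta ^ d * r ^ s] for
    [eta / Q <~ r <= Q ^ (- beta)].  It results from interpolating between
    [r ^ delta * Q ^ M] and the value [Q ^ (- beta * delta)] at
    [r = Q ^ (- beta)], where [M = tau * d - 1] trivially, and
    [M = (tau - 1 / d) * (2 * d - delta - 1)] for [theta = 0], because rational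
    points of denominator about [Q] in a ball of radius [c * Q ^ (- 1 - 1 / d)]
    lie on a hyperplane. *)

(** * Real powers and series *)

(** Local counting says nothing about balls of radius below [Q ^ (- beta)], while the balls produced
    by the descent have radius about [eta / Q], which is far smaller. In this gap an upper bound for
    the mass is enough: a lower bound is needed only in the current ball, whose radius is fixed
    before [Q] is chosen. Two weights are carried for this reason: [delta]-weights express sparsity
    of the cover relative to [mu], and [s]-weights control the small sets, whose neighbourhoods fall
    into the gap. The number [kappa] is the [s] for which [Q * eta ^ d] equals
    [(eta / Q) ^ (delta - s)] when [eta = Q ^ (- tau)]; it is critical for the upper bound and for
    the smallest scale of the lower bound. Interpolation itself allows [s] up to
    [beta * delta ^ 2 / (beta * delta + M)]. The first entry of the minima,
    [delta - M * kappa / (beta * delta)], follows from this: an [s] below it and below [kappa]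
    satisfies [M * s <= M * kappa <= (delta - s) * beta * delta]. *)

Section real_powers.
Context {R : realType}.

Lemma powRDp (x a b : R) : 0 < x -> x `^ (a + b) = x `^ a * x `^ b.
Proof. by move=> x0; rewrite powRD// (gt_eqF x0) implybT. Qed.

Lemma powR_inv (x e : R) : 0 <= x -> x^-1 `^ e = (x `^ e)^-1.
Proof. by move=> x0; rewrite -(powR_inv1 x0) -powRrM mulN1r powRN. Qed.

Lemma powR_exprn (x a : R) n : 0 <= x -> (x `^ a) ^+ n = (x ^+ n) `^ a.
Proof.
by move=> x0; rewrite -powR_mulrn ?powR_ge0// -powRrM mulrC powRrM powR_mulrn.
Qed.

Lemma powR_dec (a s t : R) : 0 <= a <= 1 -> 0 <= s -> s <= t -> a `^ t <= a `^ s.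
Proof.
move=> /andP[a0 a1] s0 st.
have le1 e : 0 <= e -> a `^ e <= 1.
  by move=> e0; have := @ge0_ler_powR _ e e0 a 1; rewrite !nnegrE powR1; apply.
have [->|an0] := eqVneq a 0.
  have [->|sn0] := eqVneq s 0; first by rewrite powRr0 /powR eqxx; case: eqP => /=;
    rewrite ?ler01.
  by rewrite !powR0// gt_eqF// (lt_le_trans _ st)// lt_neqAle eq_sym sn0.
rewrite (_ : t = s + (t - s)); last by ring.
rewrite powRD ?an0 ?implybT//.
by rewrite ler_piMr ?powR_ge0// le1 ?subr_ge0.
Qed.

Lemma powR_small (e y : R) : 0 < e -> 0 < y ->
  exists2 rho : R, 0 < rho <= 1 & forall x, 0 <= x <= rho -> x `^ e <= y.
Proof.
move=> e0 y0; exists (Num.min 1 (y `^ e^-1)).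
  by rewrite lt_min ltr01 powR_gt0// ge_min lexx.
move=> x /andP[x0]; rewrite le_min => /andP[_ xy].
have := @ge0_ler_powR _ e (ltW e0) x (y `^ e^-1).
by rewrite !nnegrE powR_ge0 -powRrM mulVf ?gt_eqF// powRr1 ?(ltW y0)//; apply.
Qed.

Lemma powR_large (e y : R) : 0 < e ->
  exists2 Q0 : R, 1 <= Q0 & forall Q : R, Q0 <= Q -> y <= Q `^ e.
Proof.
move=> e0; pose y1 := Num.max y 1.
have y1_ge : 1 <= y1 by rewrite le_max lexx orbT.
exists (y1 `^ e^-1).
  by rewrite -[leLHS](powRr0 y1) ler_powR// invr_ge0 ltW.
move=> Q hQ; apply: (@le_trans _ _ y1); first by rewrite le_max lexx.
have y10 : 0 <= y1 by apply: le_trans y1_ge.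
have Q0 : 0 <= Q by apply: le_trans hQ; exact: powR_ge0.
have := @ge0_ler_powR _ e (ltW e0) (y1 `^ e^-1) Q.
by rewrite !nnegrE powR_ge0 -powRrM mulVf ?gt_eqF// powRr1//; apply.
Qed.

Lemma powR_eventually_small (e y : R) : 0 < e -> 0 < y ->
  exists2 Q0 : R, 1 <= Q0 & forall Q : R, Q0 <= Q -> Q `^ (- e) <= y.
Proof.
move=> e0 y0; have [Q0 Q01 H] := powR_large e y^-1 e0.
exists Q0 => // Q QQ0; have Qg0 : 0 < Q by lra.
by rewrite powRN -[leRHS]invrK lef_pV2 ?posrE ?invr_gt0 ?powR_gt0//; exact: H.
Qed.

(** The [r]-neighbourhood of a set of size [u] has size up to [3 * max u r], too large when [u < r];
    since [s <= delta], the weight [(u / r) ^ delta] pays for this enlargement. *)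
Lemma weight_min_max (s delta u r : R) : 0 < u -> 0 < r -> 0 <= s <= delta ->
  (Num.min 1 (u / r)) `^ delta * (3 * Num.max u r) `^ s <= 3 `^ delta * u `^ s.
Proof.
move=> u0 r0 /andP[s0 sd].
have m0 : 0 < Num.max u r by rewrite lt_max u0.
rewrite powRM// ?(ltW m0)// mulrCA.
have h3 : (3 : R) `^ s <= 3 `^ delta by apply: ler_powR => //; lra.
apply: ler_pM => //; rewrite ?mulr_ge0 ?powR_ge0//.
have [ur|ru] := leP r u.
  have -> : Num.min 1 (u / r) = 1.
    by apply: min_idPl; rewrite ler_pdivlMr// mul1r.
  by rewrite powR1 mul1r lexx.
have -> : Num.min 1 (u / r) = u / r.
  by apply: min_idPr; rewrite ler_pdivrMr// mul1r ltW.
have d0 := le_trans s0 sd.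
apply: (@le_trans _ _ ((u / r) `^ s * r `^ s)).
  apply: ler_pM; rewrite ?powR_ge0//.
  apply: powR_dec => //; apply/andP; split; first by rewrite divr_ge0 ?ltW.
  by rewrite ler_pdivrMr// mul1r ltW.
by rewrite -powRM ?divr_ge0 ?(ltW u0) ?(ltW r0)// divfK ?gt_eqF.
Qed.

(* The two bounds cross at [r = Q `^ (- (beta + M / delta))], where both equal
   [r `^ (beta * delta ^+ 2 / (beta * delta + M))]. *)
Lemma powR_interp (Q r s delta beta M : R) : 1 <= Q -> 0 < r -> 0 < s -> s <= delta ->
  s * (beta * delta + M) <= beta * delta ^+ 2 ->
  r `^ delta * Q `^ M <= r `^ s \/ Q `^ (- (beta * delta)) <= r `^ s.
Proof.
move=> Q1 r0 s0 sd hs.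
have Q0 : 0 < Q by lra.
have [h|h] := leP (Q `^ (- (beta * delta))) (r `^ s); [by right|left].
have -> : r `^ delta = r `^ s * r `^ (delta - s) by rewrite -powRDp//; congr (_ `^ _); ring.
rewrite -mulrA ler_piMr ?powR_ge0//.
(* The failed alternative, raised to the power [(delta - s) / s], absorbs [Q ^ M]. *)
have hr : r `^ (delta - s) <= (Q `^ (- (beta * delta))) `^ ((delta - s) / s).
  have -> : r `^ (delta - s) = (r `^ s) `^ ((delta - s) / s).
    by rewrite -powRrM mulrC divfK ?gt_eqF.
  apply: ge0_ler_powR; rewrite ?nnegrE ?powR_ge0 ?(ltW h)//.
  by rewrite divr_ge0 ?(ltW s0)// subr_ge0.
apply: (@le_trans _ _ ((Q `^ (- (beta * delta))) `^ ((delta - s) / s) * Q `^ M)).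
  by rewrite ler_wpM2r ?powR_ge0.
rewrite -powRrM -powRDp// -(powRr0 Q) ler_powR//.
have : - (beta * delta) * ((delta - s) / s) + M =
    (s * (beta * delta + M) - beta * delta ^+ 2) / s by field; rewrite gt_eqF.
move=> ->; rewrite ler_pdivrMr// mul0r; lra.
Qed.

Lemma geometric_tail (c z e : R) : 0 <= c -> 0 <= z -> z < 1 -> 0 < e ->
  exists k0, forall k1, (k0 <= k1)%N -> (\sum_(0 <= k <oo) (c * z ^+ (k1 + k))%:E <= e%:E)%E.
Proof.
move=> c0 z0 z1 e0.
have h0 k : (0 <= (c * z ^+ k)%:E)%E by rewrite lee_fin mulr_ge0 ?exprn_ge0.
have part k1 : (\sum_(0 <= k <oo) (c * z ^+ (k1 + k))%:E <= (c / (1 - z) * z ^+ k1)%:E)%E.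
  apply: lime_le.
    by apply: is_cvg_nneseries => n _ _; exact: h0.
  apply: nearW => n; rewrite sumEFin lee_fin.
  have -> : \sum_(0 <= i < n) c * z ^+ (k1 + i) = c * z ^+ k1 * \sum_(i < n) z ^+ i.
    rewrite big_mkord big_distrr/=; apply: eq_bigr => i _.
    by rewrite exprD mulrA.
  have z1' : 0 < 1 - z by lra.
  rewrite [leRHS]mulrAC ler_wpM2l ?mulr_ge0 ?exprn_ge0//.
  rewrite -[leRHS]mul1r ler_pdivlMr// mulrC.
  have := subrX1 z n; have : 0 <= z ^+ n by rewrite exprn_ge0.
  lra.
have z1' : 0 < 1 - z by lra.
have := cvg_expr (z := z); rewrite ger0_norm// => /(_ z1).
pose c' := c / (1 - z) + 1.
have c'0 : 0 < c' by rewrite ltr_wpDl// divr_ge0// ltW.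
move=> /cvgrPdist_lt/(_ (e / c')) /(_ (divr_gt0 e0 c'0)) [k0 _ Hk].
exists k0 => k1 k01; apply: le_trans (part k1) _; rewrite lee_fin.
have := Hk k1 k01; rewrite /= sub0r normrN ger0_norm ?exprn_ge0// ltr_pdivlMr// => h.
have : 0 <= z ^+ k1 by rewrite exprn_ge0.
by move: h; rewrite /c' mulrDr mulr1 mulrC; lra.
Qed.

End real_powers.

Section series.
Context {R : realType}.

Lemma nneseries_ge_term (f : nat -> \bar R) (i : nat) :
  (forall j, (0 <= f j)%E) -> (f i <= \sum_(0 <= j <oo) f j)%E.
Proof.
move=> f0; apply: (@le_trans _ _ (\sum_(0 <= j < i.+1) f j)%E).
  by rewrite big_nat_recr//= leeDr// sume_ge0.
by apply: nneseries_lim_ge.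
Qed.

(** The finitely many terms before a small tail have a positive minimum; a threshold below it leaves
    only tail terms. *)
Lemma small_terms (u : nat -> R) (s e : R) : (forall i, 0 < u i) ->
  (\sum_(0 <= i <oo) (u i `^ s)%:E < +oo)%E -> 0 < e ->
  exists2 b0 : R, 0 < b0 & forall b, b <= b0 ->
    (\sum_(0 <= i <oo) (if u i < b then u i `^ s else 0)%:E <= e%:E)%E.
Proof.
move=> u0 su e0.
have f0 k : true -> (0 <= (u k `^ s)%:E)%E by rewrite lee_fin powR_ge0.
have := @nneseries_tail_cvg _ (fun i => (u i `^ s)%:E) xpredT su f0.
move=> /(_ [set x | (x < e%:E)%E]) [|N _ /(_ N (leqnn _)) /= tailN].
  by apply: open_nbhs_nbhs; split; [exact: open_ereal_lt_ereal|rewrite /= lte_fin].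
have [b0 b00 hb0] : exists2 b0 : R, 0 < b0 & forall i, (i < N)%N -> b0 <= u i.
  elim: N {tailN} => [|N [b b_gt0 hb]]; first by exists 1.
  exists (Num.min b (u N)); first by rewrite lt_min b_gt0 u0.
  move=> i; rewrite ltnS leq_eqVlt => /predU1P[->|/hb ib]; rewrite ge_min ?lexx ?orbT//.
  by rewrite ib.
exists b0 => // b bb0.
have t0 k : (0 <= (if u k < b then u k `^ s else 0)%:E)%E.
  by case: ifP; rewrite lee_fin ?powR_ge0.
rewrite (nneseries_split 0 N)// add0n big_nat big1 ?add0e; last first.
  move=> i iN; rewrite ltNge (le_trans bb0)// hb0//.
apply: le_trans (ltW tailN); apply: lee_nneseries => [i _ _//|i _].
by case: ifP; rewrite lee_fin ?powR_ge0.
Qed.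

End series.

(** * Hausdorff measure of limsup sets *)

(** The series of the hypothesis is the integral over [D] of the sum in the conclusion; if that sum
    were at least 1 on all of [D], the integral would be at least [mu D]. *)
Lemma first_moment d (T : measurableType d) (R : realType)
    (mu : {measure set T -> \bar R}) (D : set T) (E : nat -> set T) (a : nat -> R) :
  measurable D -> (forall i, measurable (E i)) -> (forall i, 0 <= a i) ->
  (\sum_(0 <= i <oo) ((a i)%:E * mu (E i `&` D)) < mu D)%E ->
  exists2 x, D x & (\sum_(0 <= i <oo) (a i * \1_(E i) x)%:E < 1)%E.
Proof.
move=> mD mE a0; apply: contraPP => /forall2NP H.
apply/negP; rewrite -leNgt.
have mf i : measurable_fun D (fun x => (a i * \1_(E i) x)%:E : \bar R).
  by apply/measurable_EFinP; apply: measurable_funM;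
    [exact: measurable_cst|exact: measurable_indic].
have f0 i x : (0 <= (a i * \1_(E i) x)%:E)%E by rewrite lee_fin mulr_ge0.
have -> : (\sum_(0 <= i <oo) ((a i)%:E * mu (E i `&` D)) =
   \int[mu]_(x in D) \sum_(0 <= i <oo) (a i * \1_(E i) x)%:E)%E.
  rewrite integral_nneseries//; apply: eq_eseriesr => i _.
  under eq_integral do rewrite EFinM.
  rewrite ge0_integralZl_EFin//; last first.
    by apply/measurable_EFinP; exact: measurable_indic.
  by rewrite integral_indic.
rewrite -[leLHS]mul1e -integral_cst//; apply: ge0_le_integral => //.
- exact: ge0_emeasurable_sum.
- by move=> x Dx; case: (H x) => // /negP; rewrite -leNgt.
Qed.

Section load.
Context {R : realType} {d : nat}.
Local Notation V := 'rV[R]_d.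

Lemma open_measurable_rV (A : set V) :
  open A -> measurable (A : set (borel_rV R d)).
Proof. exact: sub_sigma_algebra. Qed.

Lemma ballE_rV (x y : V) r : ball x r y = (`|x - y| < r) :> Prop.
Proof. by rewrite -ball_normE. Qed.

Lemma ball_open_rV (x : V) r : open (ball x r).
Proof.
have [r0|r0] := ltP 0 r; first exact: ball_open.
suff -> : ball x r = set0 by exact: open0.
rewrite -subset0 => y; rewrite ballE_rV => h.
by have := le_lt_trans (normr_ge0 _) h; rewrite ltNge r0.
Qed.

(* The descent keeps the load of a ball of radius [r] below [eps * r `^ delta],
   so that every [U i] meeting it has size less than [r]. *)
Definition load (U : nat -> set V) (u : nat -> R) (delta : R) (B : set V) : \bar R :=
  (\sum_(0 <= i <oo) (if `[< U i `&` B !=set0 >] then u i `^ delta else 0)%:E)%E.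

Lemma probability_setIK (mu : probability (borel_rV R d) R) (K B : set V) :
  measurable (K : set (borel_rV R d)) -> mu K = 1%E ->
  measurable (B : set (borel_rV R d)) -> mu (B `&` K) = mu B.
Proof.
move=> mK muK mB; apply/eqP; rewrite eq_le; apply/andP; split.
  by apply: le_measure; rewrite ?inE//; exact: measurableI.
have mBK := measurableI _ _ mB mK.
have mCK := measurableC mK.
have -> : mu B = mu ((B `&` K) `|` (B `&` ~` K)) by rewrite -setIUr setUv setIT.
apply: (le_trans (measureU2 _ mBK _)); first exact: measurableI.
rewrite -[leRHS]adde0; apply: leeD => //.
apply: (@le_trans _ _ (mu (~` K))).
  by apply: le_measure; rewrite ?inE//; exact: measurableI.
by rewrite probability_setC// muK subee.
Qed.

(* The centre of the new ball is found by a first moment bound: a set of size at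
   least [b] counts fully, hence is avoided, and a smaller one counts with weight
   [eps^-1 * min 1 (u i / r') `^ delta]; the total is less than the mass of [A]. *)
Lemma nested_step (mu : probability (borel_rV R d) R) (K A : set V)
    (U : nat -> set V) (u : nat -> R) (delta s C m b eps r r' : R) (x : V) :
  measurable (K : set (borel_rV R d)) -> mu K = 1%E -> open A ->
  0 < m -> 0 <= s <= delta -> 1 <= C -> 0 < eps <= 1 ->
  2 * C ^+ 2 * 6 `^ delta * eps < 1 ->
  (forall i, 0 < u i) ->
  (forall i y z, U i y -> U i z -> `|y - z| <= u i) ->
  0 < r' -> r' <= b -> b <= r / 2 -> 3 * b <= 1 ->
  ((C^-1 * m * (r / 2) `^ delta)%:E <= mu (ball x (r / 2) `&` A))%E ->
  (forall y t, K y -> b <= t -> (mu (ball y t `&` A) <= (C * m * t `^ delta)%:E)%E) ->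
  (forall y t, K y -> r' <= t -> t <= 1 -> (mu (ball y t `&` A) <= (C * m * t `^ s)%:E)%E) ->
  (load U u delta (ball x r) <= (eps * r `^ delta)%:E)%E ->
  (\sum_(0 <= i <oo) (if u i < b then u i `^ s else 0)%:E <= (eps ^+ 2 * r `^ delta)%:E)%E ->
  exists x', [/\ K x', A x', `|x - x'| < r / 2
    & (load U u delta (ball x' r') <= (eps * r' `^ delta)%:E)%E].
Proof.
move=> mK muK oA m0 /andP[s0 sd] C1 /andP[e0 e1] Ce u0 Uu r'0 r'b br b3 lowb upd ups hl tail.
have b0 : 0 < b := lt_le_trans r'0 r'b.
have r0 : 0 < r by lra.
pose D : set V := ball x (r / 2) `&` A `&` K.
(* A centre outside [E i] has its ball of radius [r'] disjoint from [U i]. *)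
pose E i : set V := \bigcup_(z in U i) ball z r'.
pose a i := if u i < b then eps^-1 * (Num.min 1 (u i / r')) `^ delta else 1.
have mbA : measurable (ball x (r / 2) `&` A : set (borel_rV R d)).
  by apply: open_measurable_rV; apply: openI => //; exact: ball_open_rV.
have oE i : open (E i) by apply: bigcup_open => z _; exact: ball_open_rV.
have mE i : measurable (E i : set (borel_rV R d)) by exact: open_measurable_rV.
have mD : measurable (D : set (borel_rV R d)) by apply: measurableI.
have muD : mu D = mu (ball x (r / 2) `&` A).
  exact: probability_setIK.
have a0 i : 0 <= a i.
  by rewrite /a; case: ifP => // _; rewrite mulr_ge0 ?powR_ge0 ?invr_ge0 ?ltW.
pose h i : R := if `[< U i `&` ball x r !=set0 >] then u i `^ delta else 0.
pose t i : R := if u i < b then u i `^ s else 0.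
have h0 i : 0 <= h i by rewrite /h; case: ifP => // _; exact: powR_ge0.
have t0 i : 0 <= t i by rewrite /t; case: ifP => // _; exact: powR_ge0.
have key i : ((a i)%:E * mu (E i `&` D) <=
    (C * m * 3 `^ delta)%:E * (h i + eps^-1 * t i)%:E)%E.
  have C0 : 0 < C by lra.
  have Cm0 : 0 < C * m by rewrite mulr_gt0.
  have rhs0 : 0 <= C * m * 3 `^ delta * (h i + eps^-1 * t i).
    by rewrite !mulr_ge0 ?powR_ge0 ?addr_ge0 ?mulr_ge0 ?invr_ge0// ltW.
  have [->|/set0P[y [[z Uz yz] [[xy Ay] Ky]]]] := eqVneq (E i `&` D) set0.
    by rewrite measure0 mule0 -EFinM lee_fin.
  rewrite ballE_rV in xy; rewrite /= ballE_rV in yz.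
  (* [U i] comes within [r' <= r / 2] of a point of [ball x (r / 2)], so it is already counted in
     the load of the old ball. *)
  have hi : h i = u i `^ delta.
    rewrite /h ifT//; apply/asboolP; exists z; split=> //; rewrite ballE_rV.
    by rewrite -[x - z](subrKA y) (le_lt_trans (ler_normD _ _))// (distrC y); lra.
  (* Two points of [E i] are less than [u i + 2 * r' <= 3 * w] apart. *)
  pose w := Num.max (u i) r'.
  have uw : u i <= w by rewrite le_max lexx.
  have rw : r' <= w by rewrite le_max lexx orbT.
  have sub : E i `&` D `<=` ball y (3 * w) `&` A.
    move=> y1 [[z1 Uz1 yz1] [[_ Ay1] _]]; split => //.
    rewrite /= ballE_rV in yz1; rewrite ballE_rV.
    have -> : y - y1 = (y - z) + ((z - z1) + (z1 - y1)).
      by rewrite addrA !subrKA.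
    have := ler_normD (y - z) ((z - z1) + (z1 - y1)).
    have := ler_normD (z - z1) (z1 - y1).
    have := Uu _ _ _ Uz Uz1; rewrite (distrC y z).
    clear -yz yz1 uw rw; lra.
  have mle : (mu (E i `&` D) <= mu (ball y (3 * w) `&` A))%E.
    apply: le_measure; rewrite ?inE//; first exact: measurableI.
    by apply: open_measurable_rV; apply: openI => //; exact: ball_open_rV.
  have w0 : 0 < w by exact: lt_le_trans rw.
  (* Large sets are charged to the load by the bound at scales above [b], small ones to the
     [s]-weights by the bound that reaches down to [r']. *)
  rewrite /a /t -EFinM; case: ifPn => ub; last first.
    have wu : w = u i by apply: max_idPl; rewrite (le_trans r'b)// leNgt.
    rewrite mul1e (le_trans mle)// (le_trans (upd _ _ Ky _))//.
      by rewrite wu; clear -ub u0 b0; rewrite -leNgt in ub; have := u0 i; lra.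
    by rewrite lee_fin hi wu powRM ?(ltW (u0 i))// mulr0 addr0 mulrA.
  apply: (@le_trans _ _ ((eps^-1 * Num.min 1 (u i / r') `^ delta)%:E *
      (C * m * (3 * w) `^ s)%:E)%E).
    apply: lee_wpmul2l; first by rewrite lee_fin mulr_ge0 ?powR_ge0// invr_ge0 ltW.
    have wb : w <= b by rewrite ge_max r'b (ltW ub).
    apply: (le_trans mle); apply: ups => //; clear -wb b3 w0 rw; lra.
  rewrite -EFinM lee_fin.
  have := weight_min_max _ _ _ _ (u0 i) r'0 (introT andP (conj s0 sd)) .
  set p := Num.min _ _ `^ _; set q := (3 * _) `^ _ => pq.
  apply: (@le_trans _ _ (C * m * 3 `^ delta * (eps^-1 * u i `^ s))).
    rewrite (_ : eps^-1 * p * (C * m * q) = C * m * eps^-1 * (p * q)); last by ring.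
    rewrite (_ : C * m * 3 `^ delta * (eps^-1 * u i `^ s) = C * m * eps^-1 *
      (3 `^ delta * u i `^ s)); last by ring.
    by rewrite ler_pM2l// mulr_gt0// invr_gt0.
  rewrite ler_wpM2l// ?mulr_ge0 ?powR_ge0// ?(ltW m0) ?(ltW C0)//.
  by rewrite lerDr.
have S0 : (0 <= \sum_(0 <= i <oo) (h i)%:E)%E by apply: nneseries_ge0 => i _ _;
  rewrite lee_fin.
have T0 : (0 <= \sum_(0 <= i <oo) (t i)%:E)%E by apply: nneseries_ge0 => i _ _;
  rewrite lee_fin.
have C0 : 0 < C by exact: lt_le_trans C1.
have rd0 : 0 < r `^ delta by rewrite powR_gt0.
have k0 : 0 <= C * m * 3 `^ delta.
  by apply: mulr_ge0; [apply: mulr_ge0; exact: ltW|exact: powR_ge0].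
have lowD : ((C^-1 * m * (r / 2) `^ delta)%:E <= mu D)%E by rewrite muD.
have [|y Dy hy] := @first_moment _ _ _ mu D E a mD mE a0.
  apply: lt_le_trans lowD.
  apply: (@le_lt_trans _ _ (\sum_(0 <= i <oo)
      ((C * m * 3 `^ delta)%:E * (h i + eps^-1 * t i)%:E))%E).
    by apply: lee_nneseries => [i _ _|i _]; rewrite ?mule_ge0 ?lee_fin.
  rewrite nneseriesZl; last first.
    by move=> i _; rewrite lee_fin addr_ge0 ?mulr_ge0 ?invr_ge0// ltW.
  apply: (@le_lt_trans _ _ ((C * m * 3 `^ delta)%:E * (2 * eps * r `^ delta)%:E)%E).
    apply: lee_wpmul2l; first by rewrite lee_fin.
    under eq_eseriesr do rewrite EFinD EFinM.
    rewrite nneseriesD; last 2 first.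
    - by move=> i _ _; rewrite lee_fin.
    - by move=> i _ _; rewrite -EFinM lee_fin mulr_ge0 ?invr_ge0// ltW.
    rewrite nneseriesZl; last by move=> i _; rewrite lee_fin.
    (* The load contributes one [eps]; the small sets carry the factor [eps^-1], which is why their
       weight is required to be of order [eps ^ 2]. *)
    have -> : 2 * eps * r `^ delta =
        eps * r `^ delta + eps^-1 * (eps ^+ 2 * r `^ delta).
      by rewrite [eps^-1 * _]mulrA expr2 mulKf ?gt_eqF//; ring.
    rewrite EFinD; apply: leeD => //.
    rewrite [(eps^-1 * _)%:E]EFinM; apply: lee_wpmul2l => //.
    by rewrite lee_fin invr_ge0 ltW.
  rewrite -EFinM lte_fin.
  (* Halving the radius costs [2 ^ delta], the enlargement by 3 costs [3 ^ delta], the two mass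
     bounds cost [C ^ 2]: hence the condition on [eps]. *)
  have r2 : r `^ delta = (r / 2) `^ delta * 2 `^ delta.
    by rewrite -powRM ?divfK//; clear -r0; lra.
  have p6 : 6 `^ delta = 3 `^ delta * 2 `^ delta :> R.
    by rewrite -powRM//; congr (_ `^ _); clear; lra.
  have h20 : 0 < (r / 2) `^ delta by rewrite powR_gt0//; clear -r0; lra.
  rewrite r2 [ltLHS](_ : _ = C^-1 * m * (r / 2) `^ delta * (2 * C ^+ 2 * 6 `^ delta * eps)).
    by rewrite gtr_pMr// !mulr_gt0// invr_gt0.
  have CC : C = C^-1 * C ^+ 2 by rewrite expr2 mulKf ?gt_eqF.
  by rewrite p6 {1}CC; ring.
have [[xy Ay] Ky] := Dy.
exists y; split => //; first by rewrite ballE_rV in xy.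
have hE i : U i `&` ball y r' !=set0 -> E i y.
  move=> [z [Uz yz]]; exists z => //; exact: ball_sym.
have f0 i : (0 <= (a i * \1_(E i) y)%:E)%E by rewrite lee_fin mulr_ge0.
(* The sum at [y] is below 1, hence so is each [a i] with [E i y]. This excludes [u i >= b], where
   [a i = 1], and [u i >= r'], where [a i = eps^-1 >= 1]. *)
have ai i : E i y -> u i `^ delta = eps * r' `^ delta * a i /\ a i < 1.
  move=> Ei.
  have ai1 : a i < 1.
    rewrite -lte_fin; apply: le_lt_trans hy.
    have -> : (a i)%:E = (a i * \1_(E i) y)%:E.
      by rewrite indicE mem_set ?mulr1.
    exact: nneseries_ge_term (fun j => (a j * \1_(E j) y)%:E) i f0.
  split => //; move: ai1; rewrite /a; case: ifPn => [ub|_]; last by rewrite ltxx.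
  have [ur|ru] := leP r' (u i).
    have -> : Num.min 1 (u i / r') = 1.
      by apply: min_idPl; rewrite ler_pdivlMr// mul1r.
    rewrite powR1 mulr1 => h1; have : 1 <= eps^-1 by rewrite invf_ge1.
    by clear -h1; lra.
  move=> _; have -> : Num.min 1 (u i / r') = u i / r'.
    by apply: min_idPr; rewrite ler_pdivrMr// mul1r ltW.
  rewrite (mulrC eps) mulrA mulfK ?gt_eqF// -powRM ?(ltW r'0)//; last first.
    by rewrite divr_ge0 ?ltW.
  by rewrite mulrC divfK ?gt_eqF.
apply: (@le_trans _ _ (\sum_(0 <= i <oo) ((eps * r' `^ delta)%:E * (a i * \1_(E i) y)%:E))%E).
  apply: lee_nneseries => [i _ _|i _].
    by case: ifP => _; rewrite lee_fin ?powR_ge0.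
  rewrite -EFinM; case: ifPn => [/asboolP /hE Ei|_].
    by rewrite lee_fin indicE mem_set// mulr1; have [-> _] := ai _ Ei.
  by rewrite lee_fin !mulr_ge0 ?powR_ge0// ltW.
rewrite nneseriesZl//; rewrite -[leRHS]mule1.
apply: lee_wpmul2l; last exact: ltW.
by rewrite lee_fin mulr_ge0 ?powR_ge0 ?ltW.
Qed.
End load.

Section limsup.
Context {R : realType} {d : nat}.
Local Notation V := 'rV[R]_d.

(** A set containing the limit of the descent meets every ball of it. A load of at most
    [eps * r ^ delta] with [eps <= 1] bounds its size by [r], and these radii tend to 0,
    contradicting [0 < u i]. *)
Lemma uncovered_point (mu : probability (borel_rV R d) R) (K : set V)
    (T : nat -> set V) (delta s C eps : R) (U : nat -> set V) (u : nat -> R) :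
  compact K -> mu K = 1%E -> 0 < s -> s < delta -> 1 <= C -> 0 < eps <= 1 ->
  2 * C ^+ 2 * 6 `^ delta * eps < 1 ->
  (forall (e : R) (N : nat), 0 < e -> exists A : set V, exists m b r' : R,
    [/\ open A, 0 < m, 0 < r', r' <= b & b <= e] /\
    [/\ forall x t, K x -> b <= t -> t <= 1 ->
          ((C^-1 * m * t `^ delta)%:E <= mu (ball x t `&` A))%E,
        forall x t, K x -> b <= t ->
          (mu (ball x t `&` A) <= (C * m * t `^ delta)%:E)%E,
        forall x t, K x -> r' <= t -> t <= 1 ->
          (mu (ball x t `&` A) <= (C * m * t `^ s)%:E)%E
      & forall x y, A x -> `|x - y| < r' -> exists2 q, (N <= q)%N & T q y]) ->
  (forall i, 0 < u i) ->
  (forall i y z, U i y -> U i z -> `|y - z| <= u i) ->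
  (\sum_(0 <= i <oo) (u i `^ s)%:E < +oo)%E ->
  (\sum_(0 <= i <oo) (u i `^ delta)%:E <= eps%:E)%E ->
  exists x, [/\ K x, forall N, exists2 q, (N <= q)%N & T q x & forall i, ~ U i x].
Proof.
move=> cK muK s0 sd C1 /andP[e0 e1] Ce H u0 Uu us ud.
have cldK : closed K by apply: compact_closed => //; exact: norm_hausdorff.
have mK : measurable (K : set (borel_rV R d)).
  rewrite -[K]setCK; apply: measurableC; apply: open_measurable_rV.
  exact: closed_openC.
(* A state is a step index, a centre and a radius; the index is the lower bound imposed on the next
   [q], which makes the [q] unbounded in the limit. *)
pose P (p : nat * (V * R)) := [/\ K p.2.1, 0 < p.2.2 <= 1 &
  (load U u delta (ball p.2.1 p.2.2) <= (eps * p.2.2 `^ delta)%:E)%E].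
pose S (p p' : nat * (V * R)) := [/\ P p', `|p.2.1 - p'.2.1| < p.2.2 / 2,
  p'.2.2 <= p.2.2 / 4 &
  forall y, `|p'.2.1 - y| < p'.2.2 -> exists2 q, (p.1 <= q)%N & T q y].
have step p : {p' | p'.1 = p.1.+1 /\ (P p -> S p p')}.
  (* Dependent choice asks for a successor of every state, so a state violating the invariant just
     stays in place. *)
  apply: cid; case: (pselect (P p)) => [Pp|nP]; last by exists (p.1.+1, p.2).
  have [Kx /andP[r0 r1] hl] := Pp.
  move: p => [n [x r]]/= in Pp Kx r0 r1 hl *.
  have [b0 b00 hb0] := small_terms u s (eps ^+ 2 * r `^ delta) u0 us
    (mulr_gt0 (exprn_gt0 2 e0) (powR_gt0 _ r0)).
  have [|A [m [b [r' [[oA m0 r'0 r'b bE] [low up ups AT]]]]]] :=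
    H (Num.min b0 (r / 4)) n.
    by rewrite lt_min b00 divr_gt0.
  move: bE; rewrite le_min => /andP[bb0 br].
  have [|||x' [Kx' Ax' xx' hl']] := @nested_step R d mu K A U u delta s C m b eps r r' x
    mK muK oA m0 (introT andP (conj (ltW s0) (ltW sd))) C1 (introT andP (conj e0 e1)) Ce
    u0 Uu r'0 r'b _ _ _ up ups hl (hb0 _ bb0).
  - by lra.
  - by lra.
  - by apply: low => //; clear -br r0 r1; lra.
  exists (n.+1, (x', r')); split => // _; split => //=; last first.
    by move=> y; exact: AT.
    by lra.
  by split => //=; lra.
have K0 : K !=set0.
  apply/set0P/eqP => K0; move: muK; rewrite K0 measure0 => /eqP.
  by rewrite eqe eq_sym oner_eq0.
have [x0 Kx0] := K0.
have [f [f0 fS]] := dependent_choice step (0%N, (x0, 1)).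
have fP n : P (f n).
  elim: n => [|n ih]; last by have [_ /(_ ih)[]] := fS n.
  rewrite f0; split => //=; first by rewrite ltr01 lexx.
  rewrite powR1 mulr1; apply: le_trans ud; apply: lee_nneseries => [i _ _|i _].
    by case: ifP; rewrite lee_fin ?powR_ge0.
  by case: ifP; rewrite lee_fin ?powR_ge0.
have fS' n : S (f n) (f n.+1) by have [_ /(_ (fP n))] := fS n.
have fn n : (f n).1 = n by elim: n => [|n ih]; [rewrite f0|have [-> _] := fS n; rewrite ih].
pose X n := (f n).2.1; pose r n := (f n).2.2.
have r0 n : 0 < r n by have [_ /andP[]] := fP n.
have r4 n : r n.+1 <= r n / 4 by have [] := fS' n.
have XS n : `|X n - X n.+1| < r n / 2 by have [] := fS' n.
(* As [r n.+1 <= r n / 4], a move of [r n / 2] is at most 3/4 of the decrease of the radius, so the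
   moves telescope; the remaining quarter leaves room for the limit point. *)
have Xdist n k : `|X n - X (n + k)%N| <= 3 / 4 * (r n - r (n + k)%N).
  elim: k => [|k ih]; first by rewrite addn0 !subrr normr0 mulr0.
  rewrite addnS -(subrKA (X (n + k)%N)); apply: (le_trans (ler_normD _ _)).
  by have := XS (n + k)%N; have := r4 (n + k)%N; have := r0 (n + k)%N; lra.
have rn n : r n <= (4 ^+ n)^-1.
  elim: n => [|n ih]; first by have [_ /andP[]] := fP 0%N; rewrite /r expr0 invr1.
  by have := r4 n; rewrite exprS invfM; lra.
have [x [Kx clx]] : K `&` cluster (X n @[n --> \oo]) !=set0.
  by apply: cK; exists 0%N => // n _; have [] := fP n.
have xball n : `|X n - x| < r n.
  have [||y [[k nk <-]]] := clx (X @` [set k | (n <= k)%N]) (ball x (r n / 8)).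
  - by exists n => // k /= nk; exists k.
  - by apply: nbhsx_ballx; rewrite divr_gt0.
  rewrite ballE_rV => xk; have := Xdist n (k - n)%N; rewrite subnKC//.
  rewrite (distrC x) in xk.
  have -> : X n - x = (X n - X k) + (X k - x) by rewrite subrKA.
  have := ler_normD (X n - X k) (X k - x); have := r0 k; have := r0 n.
  lra.
exists x; split => //.
- move=> N; have [_ _ _ /(_ x)] := fS' N; rewrite fn; apply; exact: xball.
- move=> i Uix.
  have ui n : u i <= (4 ^+ n)^-1.
    apply: le_trans (rn n).
    have [_ _ hl] := fP n.
    rewrite leNgt; apply/negP => ru.
    have g0 j : (0 <= (if `[< U j `&` ball (f n).2.1 (f n).2.2 !=set0 >]
        then u j `^ delta else 0)%:E)%E by case: ifP; rewrite lee_fin ?powR_ge0.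
    have := nneseries_ge_term (fun j => (if `[< U j `&` ball (f n).2.1 (f n).2.2 !=set0 >]
        then u j `^ delta else 0)%:E) i g0; move=> /le_trans /(_ hl).
    rewrite ifT; last by apply/asboolP; exists x; split => //; rewrite ballE_rV; exact: xball.
    apply/negP; rewrite -ltNge lte_fin.
    have d0 := lt_trans s0 sd.
    have h1 : r n `^ delta < u i `^ delta.
      by apply: gt0_ltr_powR => //; rewrite nnegrE ltW.
    apply: le_lt_trans h1; rewrite ler_piMl ?powR_ge0//.
  have ui0 : 0 <= (u i)^-1 by rewrite invr_ge0 ltW.
  have := archi_boundP ui0; set n := Num.bound _ => hn.
  have h4 : n%:R <= (4 : R) ^+ n by rewrite -natrX ler_nat ltnW// ltn_expl.
  have := ui n; apply/negP;
    rewrite -ltNge -[ltRHS]invrK ltf_pV2 ?posrE ?invr_gt0// ?exprn_gt0//.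
  exact: lt_le_trans h4.
Qed.

(* [A] may depend on the cover through the threshold [e], which is why no measure
   on the limsup set has to be constructed. *)
Lemma hausdorff_limsup (mu : probability (borel_rV R d) R) (K : set V)
    (T : nat -> set V) (delta s C : R) :
  compact K -> mu K = 1%E -> 0 < s -> s < delta -> 1 <= C ->
  (forall (e : R) (N : nat), 0 < e -> exists A : set V, exists m b r' : R,
    [/\ open A, 0 < m, 0 < r', r' <= b & b <= e] /\
    [/\ forall x t, K x -> b <= t -> t <= 1 ->
          ((C^-1 * m * t `^ delta)%:E <= mu (ball x t `&` A))%E,
        forall x t, K x -> b <= t ->
          (mu (ball x t `&` A) <= (C * m * t `^ delta)%:E)%E,
        forall x t, K x -> r' <= t -> t <= 1 ->
          (mu (ball x t `&` A) <= (C * m * t `^ s)%:E)%E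
      & forall x y, A x -> `|x - y| < r' -> exists2 q, (N <= q)%N & T q y]) ->
  hausdorff_measure s (K `&` [set x | forall N, exists2 q, (N <= q)%N & T q x]) = +oo%E.
Proof.
move=> cK muK s0 sd C1 H; apply: eq_infty => M0.
pose M := Num.max M0 1.
apply: (@le_trans _ _ M%:E); first by rewrite lee_fin le_max lexx.
have M1 : 1 <= M by rewrite le_max lexx orbT.
have M2 : 0 < M + 1 by lra.
have p6 : 0 < (6 : R) `^ delta by rewrite powR_gt0.
pose eps : R := Num.min 1 (4 * C ^+ 2 * 6 `^ delta)^-1.
have CC : 0 < 4 * C ^+ 2 * 6 `^ delta by rewrite !mulr_gt0 ?exprn_gt0//; lra.
have e0 : 0 < eps by rewrite lt_min ltr01 invr_gt0.
have e1 : eps <= 1 by rewrite ge_min lexx.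
have Ce : 2 * C ^+ 2 * 6 `^ delta * eps < 1.
  have : (4 * C ^+ 2 * 6 `^ delta) * eps <= 1.
    by rewrite mulrC -ler_pdivlMr// mul1r ge_min lexx orbT.
  have : 0 < (4 * C ^+ 2 * 6 `^ delta) * eps by rewrite mulr_gt0.
  by lra.
(* For sizes up to [rho] the [delta]-weight is at most [eps / (M + 1)] times the [s]-weight, so an
   [s]-weight of at most [M + 1] gives the initial load [eps] in the ball of radius 1. *)
have [||rho /andP[rho0 rho1] hrho] := powR_small (delta - s) (eps / (M + 1)).
- by rewrite subr_gt0.
- by rewrite divr_gt0.
apply: (@le_trans _ _ (hausdorff_premeasure s rho
  (K `&` [set x | forall N, exists2 q, (N <= q)%N & T q x]))); last first.
  by apply: ereal_sup_ubound; exists rho.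
apply: le_ereal_inf_tmp => _ [U [cov dU] <-].
rewrite leNgt; apply/negP => sumM.
have dU0 i : (0 <= diam (U i))%E by apply: ereal_sup_ubound; left.
have dfin i : diam (U i) \is a fin_num.
  by rewrite ge0_fin_numE// (le_lt_trans (dU i)) ?ltry.
(* Diameters may vanish, but the descent needs positive sizes. The [s]-weights of this padding add
   up to at most 1, whence [M + 1]. *)
pose t i : R := Num.min rho ((1 / (2 ^ i.+1)%:R) `^ s^-1).
have t0 i : 0 < t i by rewrite lt_min rho0 powR_gt0// divr_gt0// ltr0n expn_gt0.
have ts i : t i `^ s <= 1 / (2 ^ i.+1)%:R.
  have q0 : 0 <= 1 / (2 ^ i.+1)%:R :> R by rewrite divr_ge0.
  have := @ge0_ler_powR _ s (ltW s0) (t i) ((1 / (2 ^ i.+1)%:R) `^ s^-1).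
  rewrite !nnegrE powR_ge0 (ltW (t0 i)) -powRrM mulVf ?gt_eqF// powRr1//; apply => //.
  by rewrite ge_min lexx orbT.
pose u i := Num.max (fine (diam (U i))) (t i).
have u0 i : 0 < u i by rewrite lt_max t0 orbT.
have urho i : u i <= rho.
  by rewrite ge_max ge_min lexx/= andbT -lee_fin fineK.
have us i : ((u i `^ s)%:E <= diam_pow s (U i) + (1 / (2 ^ i.+1)%:R)%:E)%E.
  rewrite /u; have [_|dt] := leP (fine (diam (U i))) (t i).
    rewrite -[leLHS]add0e; apply: leeD; last by rewrite lee_fin.
    rewrite /diam_pow ltNge (ltW s0)/=; case: ifP => // _; exact: poweR_ge0.
  have Ui0 : U i != set0.
    apply/eqP => Ui0; move: dt; rewrite Ui0.
    suff -> : diam (set0 : set V) = 0%E by rewrite /= ltNge (ltW (t0 i)).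
    apply/eqP; rewrite eq_le; apply/andP; split.
      by apply: ge_ereal_sup => _ [->//|[y []]].
    by apply: ereal_sup_ubound; left.
  rewrite /diam_pow (negbTE Ui0) ltNge (ltW s0)/= -[leLHS]adde0; apply: leeD.
    by rewrite -poweR_EFin fineK.
  by rewrite lee_fin divr_ge0.
have sus : (\sum_(0 <= i <oo) (u i `^ s)%:E <= (M + 1)%:E)%E.
  apply: (@le_trans _ _ (\sum_(0 <= i <oo) (diam_pow s (U i) + (1 / (2 ^ i.+1)%:R)%:E))%E).
    by apply: lee_nneseries => i *; rewrite ?lee_fin ?powR_ge0.
  apply: le_trans (epsilon_trick _ _ _) _ => //.
    move=> i; rewrite /diam_pow ltNge (ltW s0)/=; case: ifP => // _; exact: poweR_ge0.
  by rewrite EFinD leeD// ltW.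
have [||||x [Kx limx nUx]] :=
  @uncovered_point mu K T delta s C eps U u cK muK s0 sd C1 _ Ce H u0.
- by rewrite e0.
- move=> i y z Uy Uz; rewrite le_max -lee_fin fineK//; apply/orP; left.
  by apply: ereal_sup_ubound; right; exists y => //; exists z.
- by apply: le_lt_trans sus _; rewrite ltry.
- apply: (@le_trans _ _ (\sum_(0 <= i <oo) ((eps / (M + 1))%:E * (u i `^ s)%:E))%E).
    apply: lee_nneseries => [i _ _|i _]; first by rewrite lee_fin powR_ge0.
    rewrite -EFinM lee_fin (_ : delta = (delta - s) + s); last by ring.
    rewrite powRD; last by rewrite (gt_eqF (u0 i)) implybT.
    by rewrite ler_wpM2r ?powR_ge0// hrho// ltW//= urho.
  rewrite nneseriesZl; last by move=> i _; rewrite lee_fin powR_ge0.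
  apply: (@le_trans _ _ ((eps / (M + 1))%:E * (M + 1)%:E)%E).
    by apply: lee_wpmul2l => //; rewrite lee_fin divr_ge0// ltW.
  by rewrite -EFinM divfK// gt_eqF.
have [i _ Uix] := cov x (conj Kx limx).
exact: nUx Uix.
Qed.

End limsup.

(** * Regular measures and packings *)

Section regularity.
Context {R : realType} {d : nat}.
Local Notation V := 'rV[R]_d.
Implicit Types (mu : probability (borel_rV R d) R) (K S : set V).

Lemma le_mu mu (A B : set V) : measurable (A : set (borel_rV R d)) ->
  measurable (B : set (borel_rV R d)) -> A `<=` B -> (mu A <= mu B)%E.
Proof. by move=> mA mB AB; apply: le_measure; rewrite ?inE. Qed.

Lemma measurable_ball_rV (x : V) r : measurable (ball x r : set (borel_rV R d)).
Proof. by apply: open_measurable_rV; exact: ball_open_rV. Qed.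

Lemma compact_measurable_rV K : compact K -> measurable (K : set (borel_rV R d)).
Proof.
move=> cK; rewrite -[K]setCK; apply: measurableC; apply: open_measurable_rV.
by apply: closed_openC; apply: compact_closed => //; exact: norm_hausdorff.
Qed.

Lemma norm_const_rV (a : R) : (1 <= d)%N -> `|const_mx a : V| = `|a|.
Proof.
move=> d1; rewrite {1}/Num.norm/= mx_normrE.
apply/le_anti/andP; split.
  by apply: bigmax_le => // i _; rewrite mxE.
have i0 : 'I_d by exists 0%N.
by apply: le_trans (le_bigmax _ _ (ord0, i0)); rewrite /= mxE.
Qed.

Lemma coord_le_norm (x : V) j : `|x ord0 j| <= `|x|.
Proof.
rewrite [leRHS]/Num.norm/= mx_normrE.
by apply: le_trans (le_bigmax _ _ (ord0, j)).
Qed.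

Lemma norm_rV_le (x : V) (e : R) : 0 <= e -> (forall j, `|x ord0 j| <= e) -> `|x| <= e.
Proof.
move=> e0 h; rewrite [leLHS]/Num.norm/= mx_normrE; apply: bigmax_le => // -[i j] _ /=.
by rewrite ord1.
Qed.

Lemma diam_ge0 (A : set V) : (0 <= diam A)%E.
Proof. by apply: ereal_sup_ubound; left. Qed.

Lemma dist_le_diam (A : set V) x y : A x -> A y -> (`|x - y|%:E <= diam A)%E.
Proof. by move=> Ax Ay; apply: ereal_sup_ubound; right; exists x => //; exists y. Qed.

Lemma diam_ball_ge (x : V) r : (1 <= d)%N -> 0 < r -> (r%:E <= diam (ball x r))%E.
Proof.
move=> d1 r0; pose c : V := const_mx (r / 2).
have nc : `|c| = r / 2 by rewrite norm_const_rV// ger0_norm// ltW// divr_gt0.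
have rE : r = `|(x + c) - (x - c)|.
  have -> : (x + c) - (x - c) = const_mx r.
    by apply/matrixP => i j; rewrite !mxE; lra.
  by rewrite norm_const_rV// ger0_norm// ltW.
rewrite {1}rE; apply: dist_le_diam; rewrite ballE_rV.
  by rewrite opprD addrA subrr add0r normrN nc; lra.
by rewrite opprB addrC subrK nc; lra.
Qed.

Lemma diam_ball_le (x : V) r : 0 < r -> (diam (ball x r) <= (2 * r)%:E)%E.
Proof.
move=> r0; apply: ge_ereal_sup => _ [->|[y yb [z zb <-]]]; rewrite lee_fin; first by lra.
rewrite ballE_rV in yb; rewrite ballE_rV in zb.
rewrite -(subrKA x); apply: (le_trans (ler_normD _ _)).
by rewrite (distrC y); lra.
Qed.

Definition regular K mu (delta C : R) := [/\ 1 <= C,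
  forall x r, K x -> 0 < r -> (mu (ball x r) <= (C * r `^ delta)%:E)%E &
  forall x r, K x -> 0 < r -> r <= 1 -> ((C^-1 * r `^ delta)%:E <= mu (ball x r))%E].

Lemma ahlfors_regular_balls K mu delta : 0 < delta ->
  ahlfors_regular K mu delta -> (0 < diam K)%E ->
  exists C, regular K mu delta C.
Proof.
move=> delta0 [C C1 H] dK.
have C0 : 0 < C by lra.
have [D D0 HD] : exists2 D : R, 0 < D & forall r : R, (r%:E < diam K)%E \/ D <= r.
  case: (diam K) dK => [D| |//] D0; first exists D => //.
    by move=> r; have [|] := leP D r; [right|left].
  by exists 1 => // r; left; rewrite ltry.
have HD2 : ((D / 2)%:E < diam K)%E by have [//|DD] := HD (D / 2); exfalso; lra.
(* A radius of at most 1 divided by [M] is at most [D / 2], below the diameter; a radius [r >= D]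
   has [M * r >= 1], so the total mass 1 is a sufficient bound. *)
pose M := Num.max 1 (2 / D).
have M1 : 1 <= M by rewrite le_max lexx.
have M2 : 2 / D <= M by rewrite le_max lexx orbT.
have M0 : 0 < M by lra.
have Md : 1 <= M `^ delta by rewrite -(powRr0 M) ler_powR// ltW.
exists (C * M `^ delta); split.
- by rewrite -[1]mulr1 ler_pM.
- move=> x r Kx r0; have [rD|rD] := HD r.
    have /andP[_] := H _ _ Kx r0 rD; move/le_trans; apply.
    by rewrite lee_fin ler_wpM2r ?powR_ge0// ler_peMr// ltW.
  apply: (@le_trans _ _ 1%E).
    by apply: probability_le1; exact: measurable_ball_rV.
  rewrite lee_fin -mulrA -powRM ?(ltW M0) ?(ltW r0)//.
  rewrite -[1]mulr1 ler_pM// -(powRr0 (M * r)) ler_powR ?(ltW delta0)//.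
  apply: (@le_trans _ _ (2 / D * r)); last by rewrite ler_wpM2r// ltW.
  by rewrite mulrAC ler_pdivlMr// mul1r; lra.
- move=> x r Kx r0 r1.
  have rM0 : 0 < r / M by rewrite divr_gt0.
  have rMD : ((r / M)%:E < diam K)%E.
    apply: le_lt_trans HD2; rewrite lee_fin ler_pdivrMr//.
    apply: (@le_trans _ _ 1) => //.
    have := M2; rewrite ler_pdivrMr// => h.
    by rewrite (mulrC D) -mulrA (mulrC _ M); lra.
  have /andP[low _] := H _ _ Kx rM0 rMD.
  apply: (@le_trans _ _ (mu (ball x (r / M)))); last first.
    apply: le_mu; try exact: measurable_ball_rV.
    by apply: le_ball; rewrite ler_pdivrMr// ler_peMr// ltW.
  apply: le_trans low; rewrite lee_fin invfM -mulrA ler_wpM2l ?invr_ge0 ?(ltW C0)//.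
  rewrite powRM ?(ltW r0) ?invr_ge0 ?(ltW M0)// mulrC ler_wpM2l ?powR_ge0//.
  by rewrite powR_inv ?(ltW M0).
Qed.

Lemma dist_int_ltP (x : V) e :
  dist_int x < e <-> exists z : 'rV[int]_d, `|x - map_mx intr z| < e.
Proof.
have hl : has_inf [set `|x - map_mx intr z| | z in [set: 'rV[int]_d]].
  by split; [exists `|x - map_mx intr 0|, 0|exists 0 => _ [z _ <-]].
split.
  by move=> /inf_lt-/(_ hl.1)[_ [z _ <-] ze]; exists z.
by move=> [z ze]; apply: le_lt_trans ze; apply: ge_inf; [exact: hl.2|exists z].
Qed.

Lemma dist_intD (x y : V) e e' : dist_int x < e -> `|x - y| <= e' -> dist_int y < e + e'.
Proof.
move=> /dist_int_ltP[z xz] xy; apply/dist_int_ltP; exists z.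
rewrite -(subrKA x); have := ler_normD (y - x) (x - map_mx intr z).
by rewrite (distrC y); lra.
Qed.

(** Denominators are below [2 * Q], so multiplying by one of them turns a displacement of
    [eta' / (2 * Q)] into at most [eta']. *)
Lemma A_nbhs (Q eta eta' : R) (theta x y : V) : 0 < Q ->
  A_ Q eta theta x -> `|x - y| <= eta' / (2 * Q) -> A_ Q (eta + eta') theta y.
Proof.
move=> Q0 [q [/andP[Qq qQ] dx]] xy; exists q; split; first by rewrite Qq.
apply: dist_intD dx _.
have -> : q%:R *: x - theta - (q%:R *: y - theta) = q%:R *: (x - y).
  by rewrite opprB addrA subrK scalerBr.
rewrite normrZ ger0_norm//; move: xy; rewrite ler_pdivlMr; last by lra.
apply: le_trans; rewrite mulrC ler_wpM2l// ltW//.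
Qed.

Lemma A_open (Q eta : R) (theta : V) : 0 < Q -> open (A_ Q eta theta).
Proof.
move=> Q0; rewrite openE => x [q [qQ /dist_int_ltP[z xz]]].
pose e := eta - `|q%:R *: x - theta - map_mx intr z|.
have e0 : 0 < e by rewrite subr_gt0.
have q1 : 0 < q%:R + 1 :> R by rewrite ltr_wpDl.
have eq0 : 0 < e / (q%:R + 1) by rewrite divr_gt0.
apply: filterS (nbhsx_ballx x _ eq0).
move=> y; rewrite ballE_rV ltr_pdivlMr// => xy.
exists q; split => //; apply/dist_int_ltP; exists z.
have -> : q%:R *: y - theta - map_mx intr z =
    (q%:R *: x - theta - map_mx intr z) - q%:R *: (x - y).
  by apply/matrixP => i j; rewrite !mxE; ring.
apply: (le_lt_trans (ler_normB _ _)); rewrite normrZ ger0_norm//.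
have : q%:R * `|x - y| <= `|x - y| * (q%:R + 1).
  by rewrite mulrDr mulr1 mulrC lerDl.
rewrite /e in xy; lra.
Qed.

Lemma packing_measure K mu delta C (l : seq V) (r : R) (B : set V) :
  regular K mu delta C -> 0 < r -> r <= 1 ->
  (forall y, y \in l -> K y) -> pairwise (fun y z => 2 * r <= `|y - z|) l ->
  measurable (B : set (borel_rV R d)) -> (forall y, y \in l -> ball y r `<=` B) ->
  (((size l)%:R * (C^-1 * r `^ delta))%:E <= mu B)%E.
Proof.
move=> [C1 _ low] r0 r1 lK pl mB lB.
pose W := \bigcup_(y in [set y | y \in l]) ball y r.
have oW : open W by apply: bigcup_open => y _; exact: ball_open_rV.
apply: (@le_trans _ _ (mu W)); last first.
  by apply: le_mu => //; [exact: open_measurable_rV|move=> x [y /lB]; apply].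
rewrite {}/W in oW *; elim: l lK pl {lB oW} => [|y l ih] lK /=.
  by rewrite mul0r.
move=> /andP[yl pl].
have lK' z : z \in l -> K z by move=> zl; apply: lK; rewrite inE zl orbT.
have oW : open (\bigcup_(y in [set y | y \in l]) ball y r).
  by apply: bigcup_open => z _; exact: ball_open_rV.
have -> : \bigcup_(z in [set z | z \in y :: l]) ball z r =
    ball y r `|` \bigcup_(z in [set z | z \in l]) ball z r.
  apply/seteqP; split => x.
    move=> [z /=]; rewrite inE => /predU1P[->|zl] zx; [by left|by right; exists z].
  move=> [yx|[z zl zx]]; first by exists y => //=; rewrite inE eqxx.
  by exists z => //=; rewrite inE zl orbT.
rewrite measureU; last 3 first.
- exact: measurable_ball_rV.
- exact: open_measurable_rV.
- rewrite -subset0 => x [yx [z zl zx]].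
  rewrite ballE_rV in yx; rewrite /= ballE_rV in zx.
  have /allP/(_ z zl) := yl.
  rewrite -(subrKA x); have := ler_normD (y - x) (x - z).
  by rewrite (distrC x); lra.
rewrite -addn1 natrD mulrDl mul1r addrC EFinD; apply: leeD; last exact: ih.
by apply: low => //; apply: lK; rewrite inE eqxx.
Qed.

(** Disjoint balls have total mass at most 1, which bounds the size of a separated list; one of
    maximal size covers, since an uncovered point could be added to it. *)
Lemma packing_cover K mu delta C (S : set V) (r : R) :
  regular K mu delta C -> 0 < r -> r <= 1 -> S `<=` K ->
  exists l : seq V, [/\ forall y, y \in l -> S y,
    pairwise (fun y z => 2 * r <= `|y - z|) l &
    forall x, S x -> exists2 y, y \in l & `|y - x| < 2 * r].
Proof.
move=> reg r0 r1 SK.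
pose P (n : nat) := exists l : seq V, [/\ size l = n, forall y, y \in l -> S y &
  pairwise (fun y z => 2 * r <= `|y - z|) l].
have C0 : 0 < C by case: reg => *; lra.
have c0 : 0 < C^-1 * r `^ delta by rewrite mulr_gt0 ?invr_gt0 ?powR_gt0.
have Pb n : `[< P n >] -> (n <= Num.bound (C^-1 * r `^ delta)^-1)%N.
  move=> /asboolP [l [<- lS pl]].
  have := @packing_measure K mu delta C l r setT reg r0 r1 (fun y yl => SK _ (lS y yl)) pl
    measurableT (fun _ _ _ _ => I).
  rewrite probability_setT lee_fin -ler_pdivlMr// mul1r => h.
  by rewrite -(ler_nat R); apply: (le_trans h); apply/ltW/archi_boundP; rewrite invr_ge0 ltW.
have P0 : exists n, `[< P n >] by exists 0%N; apply/asboolP; exists [::].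
case: (ex_maxnP P0 Pb) => n /asboolP [l [sl lS pl]] nmax.
exists l; split => // x Sx; apply: contrapT => /forall2NP H.
have : (n.+1 <= n)%N; last by rewrite ltnn.
apply: nmax; apply/asboolP; exists (x :: l); split => /=; first by rewrite sl.
  by move=> y; rewrite inE => /predU1P[->//|/lS].
rewrite pl andbT; apply/allP => y yl; rewrite leNgt; apply/negP => xy.
by case: (H y) => // -[]; rewrite distrC.
Qed.

End regularity.

(** * The lower order of psi *)

Section order.
Context {R : realType}.

Implicit Types (psi : nat -> R).

Lemma infinite_nat_unbounded (A : set nat) :
  infinite_set A <-> forall N, exists2 q, (N <= q)%N & A q.
Proof.
split=> [iA N|uA /finite_seqP[s As]].
  have /infinite_setN0[q [Aq qN]] := infinite_setD iA (finite_II N).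
  by exists q => //; rewrite leqNgt; apply/negP.
have [q sq] := uA (\max_(i <- s) i).+1; rewrite As /= => qs.
by move: sq; rewrite ltnNge => /negP; apply; exact: leq_bigmax_seq.
Qed.

Let quot psi (q : nat) : \bar R := (- lne (psi q)%:E / lne (q%:R)%:E)%E.

Lemma quot_pos psi q : (1 < q)%N -> 0 < psi q ->
  quot psi q = (- ln (psi q) / ln q%:R)%:E.
Proof.
move=> q1 p0; have q1' : 1 < q%:R :> R by rewrite ltr1n.
rewrite /quot !lne_EFin//; last by rewrite (lt_trans ltr01).
by rewrite inver gt_eqF ?ln_gt0.
Qed.

Lemma quot_zero psi q : (1 < q)%N -> psi q = 0 -> quot psi q = +oo%E.
Proof.
move=> q1 p0; have q1' : 1 < q%:R :> R by rewrite ltr1n.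
rewrite /quot p0 /lne lexx ifF; last first.
  by apply/negbTE; rewrite -ltNge (lt_trans ltr01).
by rewrite inver gt_eqF ?ln_gt0// gt0_mulye// lte_fin invr_gt0 ln_gt0.
Qed.

Lemma lower_order_gt psi (t : R) : (forall q, 0 <= psi q) ->
  (t%:E < lower_order psi)%E -> exists N, forall q, (N <= q)%N -> psi q < q%:R `^ (- t).
Proof.
move=> psi0; rewrite /lower_order limn_einf_lim (cvg_lim _ (@cvg_einfs_sup R _))//.
move=> /ereal_sup_gtP[_ [n _ <-] tn]; exists (maxn n 2) => q.
rewrite geq_max => /andP[nq q2].
have q1' : 1 < q%:R :> R by rewrite ltr1n.
have q0 : 0 < q%:R :> R by rewrite (lt_trans ltr01).
have tq : (t%:E < quot psi q)%E.
  by apply: lt_le_trans tn _; apply: ereal_inf_lbound; exists q.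
have := psi0 q; rewrite le_eqVlt => /predU1P[<-|p0]; first by rewrite powR_gt0.
move: tq; rewrite quot_pos// lte_fin ltr_pdivlMr ?ln_gt0// => h.
by rewrite -ltr_ln ?posrE ?powR_gt0// ln_powR; lra.
Qed.

Lemma lower_order_lt psi (t : R) : (forall q, 0 <= psi q) ->
  (lower_order psi < t%:E)%E ->
  forall N, exists2 q, (N <= q)%N & q%:R `^ (- t) < psi q.
Proof.
move=> psi0; rewrite /lower_order limn_einf_lim (cvg_lim _ (@cvg_einfs_sup R _))// => tn N.
have : (einfs (quot psi) (maxn N 2) < t%:E)%E.
  by apply: le_lt_trans tn; apply: ereal_sup_ubound; exists (maxn N 2).
move=> /ereal_inf_ltP[_ [q /= Nq <-]].
move: Nq; rewrite geq_max => /andP[Nq q2].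
have q1' : 1 < q%:R :> R by rewrite ltr1n.
have q0 : 0 < q%:R :> R by rewrite (lt_trans ltr01).
(* A zero of [psi] has quotient [+oo], so it cannot be the chosen [q]. *)
have := psi0 q; rewrite le_eqVlt => /predU1P[p0|p0].
  by rewrite quot_zero// ltNge leey.
rewrite quot_pos// lte_fin ltr_pdivrMr ?ln_gt0// => h.
by exists q => //; rewrite -ltr_ln ?posrE ?powR_gt0// ln_powR; lra.
Qed.

End order.

(** * Local counting on a regular set *)

Section counting.
Context {R : realType} {d : nat}.
Local Notation V := 'rV[R]_d.
Implicit Types (mu : probability (borel_rV R d) R) (K S : set V).

Lemma regular_le K mu delta C C' : C <= C' -> regular K mu delta C -> regular K mu delta C'.
Proof.
move=> CC [C1 up low]; split; first by lra.
- move=> x r Kx r0; apply: (le_trans (up x r Kx r0)).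
  by rewrite lee_fin ler_wpM2r ?powR_ge0.
- move=> x r Kx r0 r1; apply: le_trans (low x r Kx r0 r1).
  by rewrite lee_fin ler_wpM2r ?powR_ge0// lef_pV2 ?posrE; lra.
Qed.

(** Mass of the ball becomes [r ^ delta] and diameter becomes radius, so that later estimates
    compare powers only. The lower half keeps [r <= 1], the range of the lower bound in
    [regular]. *)
Definition counting_bounds K mu (delta alpha beta : R) (theta : V) (Q0 C : R) :=
  forall (Q eta : R) (x : V) (r : R), Q0 <= Q ->
    Q `^ (- alpha) <= eta <= Q `^ (- d%:R^-1) -> K x -> Q `^ (- beta) <= r ->
    (mu (ball x r `&` A_ Q eta theta) <= (C * (Q * eta ^+ d) * r `^ delta)%:E)%E /\
    (r <= 1 ->
     ((C^-1 * (Q * eta ^+ d) * r `^ delta)%:E <= mu (ball x r `&` A_ Q eta theta))%E).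

Lemma measurable_ballA (x : V) r Q eta theta : 0 < Q ->
  measurable (ball x r `&` A_ Q eta theta : set (borel_rV R d)).
Proof.
move=> Q0; apply: open_measurable_rV; apply: openI; first exact: ball_open_rV.
exact: A_open.
Qed.

(* Ahlfors regularity is vacuous on a one-point set, which must be excluded: its
   mass 1 contradicts [mu (A_ Q eta theta) <= C * Q * eta ^+ d < 1]. *)
Lemma local_counting_diam K mu (alpha beta : R) (theta : V) :
  (1 <= d)%N -> compact K -> mu K = 1%E -> 0 < beta -> d%:R^-1 < alpha ->
  local_counting mu alpha beta theta -> (0 < diam K)%E.
Proof.
move=> d1 cK muK b0 da [Q0 [C [Q01 C1 H]]].
have mK := compact_measurable_rV _ cK.
have d0 : 0 < d%:R :> R by rewrite ltr0n.
have dV0 : 0 < d%:R^-1 :> R by rewrite invr_gt0.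
have K0 : K !=set0.
  apply/set0P/eqP => K0; move: muK; rewrite K0 measure0 => /eqP.
  by rewrite eqe eq_sym oner_eq0.
have [x Kx] := K0.
rewrite lt_neqAle diam_ge0 andbT; apply/eqP => dK.
have Kone y : K y -> y = x.
  move=> Ky; have := dist_le_diam _ _ _ Ky Kx; rewrite -dK lee_fin => h.
  by apply/eqP; rewrite -subr_eq0 -normr_le0.
have ball1 r : 0 < r -> mu (ball x r) = 1%E.
  move=> r0; apply/eqP; rewrite eq_le probability_le1/=; last exact: measurable_ball_rV.
  rewrite -muK; apply: le_mu => //; first exact: measurable_ball_rV.
  by move=> y /Kone ->; exact: ballxx.
have ad : 0 < alpha * d%:R - 1 by move: da; rewrite -(ltr_pM2r d0) mulVf ?gt_eqF//; lra.
have [Q1 Q11 HQ1] := powR_large _ (C + 1) ad.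
pose Q := Num.max Q0 Q1.
have QQ0 : Q0 <= Q by rewrite le_max lexx.
have QQ1 : Q1 <= Q by rewrite le_max lexx orbT.
have Qg1 : 1 <= Q by lra.
have Qg0 : 0 < Q by lra.
pose m := Q * (Q `^ (- alpha)) ^+ d.
have mE : m = (Q `^ (alpha * d%:R - 1))^-1.
  rewrite /m -powR_mulrn ?powR_ge0// -powRrM -{1}(powRr1 (ltW Qg0)) -powRDp//.
  by rewrite -powRN; congr (_ `^ _); ring.
have m0 : 0 < m by rewrite mE invr_gt0 powR_gt0.
have Cm : C * m < 1.
  by rewrite mE ltr_pdivrMr ?powR_gt0// mul1r; have := HQ1 _ QQ1; lra.
have rng : Q `^ (- alpha) <= Q `^ (- alpha) <= Q `^ (- d%:R^-1).
  by rewrite lexx ler_powR//; lra.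
have sx : supp mu x by move=> r r0; rewrite ball1.
have dQ : ((Q `^ (- beta))%:E <= diam (ball x 1))%E.
  apply: (@le_trans _ _ 1%:E); last exact: diam_ball_ge.
  by rewrite lee_fin -(powRr0 Q) ler_powR//; lra.
have := H Q (Q `^ (- alpha)) x 1 QQ0 rng sx ltr01 dQ.
rewrite -/m ball1// !mule1 -!EFinM => /andP[low up].
have mB := @measurable_ballA x 1 Q (Q `^ (- alpha)) theta Qg0.
(* The lower counting bound is positive, so the approximation set meets [K], that is, contains [x];
   it then has full mass. *)
have Ax : A_ Q (Q `^ (- alpha)) theta x.
  apply: contrapT => nAx; move: low; rewrite -(probability_setIK _ _ _ mK muK mB).
  suff -> : ball x 1 `&` A_ Q (Q `^ (- alpha)) theta `&` K = set0.
    by rewrite measure0 lee_fin leNgt mulr_gt0// invr_gt0; lra.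
  by rewrite -subset0 => y [[_ Ay] /Kone yx]; apply: nAx; rewrite -yx.
have : (1 <= (C * m)%:E)%E.
  apply: le_trans up; rewrite -muK; apply: le_mu => // y /Kone ->.
  by split => //; exact: ballxx.
by rewrite lee_fin leNgt Cm.
Qed.

(** Regularity puts [K] inside the support of [mu], and for [d >= 1] a sup-norm ball of radius [r]
    has diameter at least [r]; so counting applies to balls centred in [K] of radius at least
    [Q ^ (- beta)]. *)
Lemma local_counting_regular K mu (delta alpha beta : R) (theta : V) :
  (1 <= d)%N -> compact K -> mu K = 1%E -> 0 < delta -> ahlfors_regular K mu delta ->
  0 < beta -> d%:R^-1 < alpha -> local_counting mu alpha beta theta ->
  exists Q0 C, [/\ 1 < Q0, regular K mu delta C & counting_bounds K mu delta alpha beta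
    theta Q0 C].
Proof.
move=> d1 cK muK delta0 ahl b0 da lc.
have dK := local_counting_diam _ _ _ _ _ d1 cK muK b0 da lc.
have [C reg] := ahlfors_regular_balls _ _ _ delta0 ahl dK.
have [C1 upb lowb] := reg.
have [Q0 [C' [Q01 C'1 H]]] := lc.
have CC : C <= C * C' by rewrite ler_peMr//; lra.
exists Q0, (C * C'); split => //; first exact: regular_le reg.
have C0 : 0 < C by lra.
have C'0 : 0 < C' by lra.
move=> Q eta x r QQ0 etaQ Kx Qr.
have Qg0 : 0 < Q by lra.
have r0 : 0 < r by apply: lt_le_trans Qr; rewrite powR_gt0.
have eta0 : 0 < eta by case/andP: etaQ => + _; apply: lt_le_trans; rewrite powR_gt0.
have m0 : 0 < Q * eta ^+ d by rewrite mulr_gt0// exprn_gt0.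
have supx : supp mu x.
  move=> t t0; pose t' := Num.min t 1.
  have t'0 : 0 < t' by rewrite lt_min t0 ltr01.
  have t'1 : t' <= 1 by rewrite ge_min lexx orbT.
  apply: (@lt_le_trans _ _ (mu (ball x t'))).
    apply: lt_le_trans (lowb _ _ Kx t'0 t'1).
    by rewrite lte_fin mulr_gt0 ?invr_gt0 ?powR_gt0.
  apply: le_mu; try exact: measurable_ball_rV.
  by apply: le_ball; rewrite ge_min lexx.
have dQ : ((Q `^ (- beta))%:E <= diam (ball x r))%E.
  by apply: le_trans (diam_ball_ge _ _ d1 r0); rewrite lee_fin.
have /andP[low up] := H Q eta x r QQ0 etaQ supx r0 dQ.
move: (Q * eta ^+ d) m0 low up => m m0 low up.
split.
  apply: (le_trans up).
  rewrite (_ : C * C' * _ * _ = C' * (C * r `^ delta) * m); last by ring.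
  rewrite EFinM [(C' * _)%:E]EFinM; apply: lee_wpmul2r; first by rewrite lee_fin ltW.
  apply: lee_wpmul2l; first by rewrite lee_fin ltW.
  exact: upb.
move=> r1; apply: le_trans low.
rewrite (_ : (C * C')^-1 * _ * _ = C'^-1 * (C^-1 * r `^ delta) * m); last first.
  by rewrite invfM; ring.
rewrite EFinM [(C'^-1 * _)%:E]EFinM; apply: lee_wpmul2r; first by rewrite lee_fin ltW.
apply: lee_wpmul2l; first by rewrite lee_fin invr_ge0 ltW.
exact: lowb.
Qed.

End counting.

(** * Upper bound for the dimension *)

Section upper.
Context {R : realType} {d : nat}.
Local Notation V := 'rV[R]_d.
Implicit Types (mu : probability (borel_rV R d) R) (K S : set V).

Lemma compact_sub_ball K (x : V) : compact K -> exists2 M : R, 1 <= M & K `<=` ball x M.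
Proof.
move=> /compact_bounded /pinfty_ex_gt0 [M M0 HM].
exists (M + `|x| + 1).
  by have := normr_ge0 x; lra.
move=> y Ky; rewrite ballE_rV; have /= := HM y Ky.
by have := ler_normB x y; lra.
Qed.

(** Disjoint balls of radius [eta / (2 * Q)] centred at a net of the set lie in
    [A_ Q (2 * eta) theta], whose mass is known; this is why the range condition concerns [2 * eta].
    Comparing masses bounds the size of the net. *)
Lemma block_cover mu K (delta alpha beta Q0 C : R) (theta : V) :
  compact K -> 0 < beta -> 0 < delta -> 1 < Q0 -> regular K mu delta C ->
  counting_bounds K mu delta alpha beta theta Q0 C ->
  exists2 C' : R, 0 < C' & forall Q eta, Q0 <= Q -> eta <= Q ->
    0 < eta -> Q `^ (- alpha) <= 2 * eta <= Q `^ (- d%:R^-1) ->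
    exists l : seq V, K `&` A_ Q eta theta `<=`
        (fun x => exists2 y, y \in l & `|y - x| < eta / Q) /\
      (size l)%:R <= C' * (Q * eta ^+ d) * (eta / Q) `^ (- delta).
Proof.
move=> cK b0 delta0 Q01 reg cnt.
have [C1 _ _] := reg.
have C0 : 0 < C by lra.
have [->|/set0P[x0 Kx0]] := eqVneq K set0.
  exists 1 => // Q eta QQ0 _ eta0 _; exists [::]; split; first by rewrite set0I.
  by rewrite mul1r !mulr_ge0 ?powR_ge0 ?exprn_ge0//; lra.
have [M M1 KM] := @compact_sub_ball K x0 cK.
exists (C * (C * 2 ^+ d * (M + 1) `^ delta) * 2 `^ delta).
  by rewrite !mulr_gt0 ?exprn_gt0 ?powR_gt0//; lra.
move=> Q eta QQ0 etaQ eta0 rng.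
have Qg0 : 0 < Q by lra.
pose r := eta / (2 * Q).
have r0 : 0 < r by rewrite divr_gt0// mulr_gt0.
have r1 : r <= 1 by rewrite ler_pdivrMr ?mulr_gt0//; lra.
have r2 : 2 * r = eta / Q by rewrite /r invfM; lra.
have [l [lS pl cl]] := @packing_cover R d K mu delta C
  (K `&` A_ Q eta theta) r reg r0 r1 (@subIsetl _ _ _).
exists l; split.
  by move=> x /cl[y yl yx]; exists y => //; rewrite -r2.
pose B : set V := ball x0 (M + 1) `&` A_ Q (2 * eta) theta.
have mB : measurable (B : set (borel_rV R d)) by exact: measurable_ballA.
have lK y : y \in l -> K y by move=> /lS[].
have lB y : y \in l -> ball y r `<=` B.
  move=> yl z; rewrite ballE_rV => yz; have [Ky Ay] := lS _ yl; split.
    rewrite ballE_rV; have := KM _ Ky; rewrite ballE_rV.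
    have -> : x0 - z = (x0 - y) + (y - z) by rewrite subrKA.
    by have := ler_normD (x0 - y) (y - z); lra.
  rewrite (_ : 2 * eta = eta + eta); last by ring.
  by apply: A_nbhs Ay _ => //; rewrite ltW.
have lowB := @packing_measure R d K mu delta C l r B reg r0 r1 lK pl mB lB.
have QM : Q `^ (- beta) <= M + 1.
  apply: (@le_trans _ _ 1); last by lra.
  by rewrite -(powRr0 Q) ler_powR//; lra.
have [upB _] := cnt Q (2 * eta) x0 (M + 1) QQ0 rng Kx0 QM.
have := le_trans lowB upB; rewrite lee_fin.
have rd0 : 0 < r `^ delta by rewrite powR_gt0.
have cr0 : 0 < C^-1 * r `^ delta by rewrite mulr_gt0// invr_gt0.
rewrite -ler_pdivlMr// => /le_trans; apply.
have -> : (eta / Q) `^ (- delta) = (2 `^ delta)^-1 * (r `^ delta)^-1.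
  by rewrite -r2 powRN powRM ?(ltW r0)// invfM.
rewrite exprMn invfM invrK.
have p2 : 0 < (2 : R) `^ delta by rewrite powR_gt0.
rewrite le_eqVlt; apply/orP; left; apply/eqP.
by field; rewrite !gt_eqF.
Qed.

Lemma diam_pow_ge0 s (A : set V) : (0 <= diam_pow s A)%E.
Proof.
rewrite /diam_pow; case: ifP => // _; case: ifP => _; last exact: poweR_ge0.
by rewrite inve_ge0 poweR_ge0.
Qed.

Lemma diam_pow_ball (x : V) r s : 0 < s -> 0 < r ->
  (diam_pow s (ball x r) <= ((2 * r) `^ s)%:E)%E.
Proof.
move=> s0 r0; rewrite /diam_pow ltNge (ltW s0)/=; case: ifP => _.
  by rewrite lee_fin powR_ge0.
have := diam_ball_le x _ r0; have := diam_ge0 (ball x r).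
case: (diam _) => [D| |]//=; rewrite !lee_fin => D0 Dr.
by apply: ge0_ler_powR => //; rewrite ?nnegrE ?(ltW s0)//; lra.
Qed.

(** A bijection between [nat] and [nat * nat] flattens the lists into one sequence; indices beyond
    the end of a list give the empty set, of weight 0. *)
Lemma premeasure_cover (s rho e : R) (A : set V) (L : nat -> seq V) (rad : nat -> R) :
  0 < s -> 0 < rho -> (forall k, 0 < rad k) -> (forall k, 2 * rad k <= rho) ->
  A `<=` (fun x => exists k, exists2 y, y \in L k & `|y - x| < rad k) ->
  (\sum_(0 <= k <oo) ((size (L k))%:R * (2 * rad k) `^ s)%:E <= e%:E)%E ->
  (hausdorff_premeasure s rho A <= e%:E)%E.
Proof.
move=> s0 rho0 rad0 radrho Acov sume.
pose F (p : nat * nat) : set V :=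
  if (p.2 < size (L p.1))%N then ball (nth 0 (L p.1) p.2) (rad p.1) else set0.
have : ([set: nat] #= [set: nat * nat])%card by rewrite card_eq_sym; exact: card_nat2.
move=> /card_set_bijP[f bijf].
apply: le_trans sume.
have F0 p : (0 <= diam_pow s (F p))%E by exact: diam_pow_ge0.
apply: (@le_trans _ _ (\sum_(0 <= i <oo) diam_pow s (F (f i)))%E).
  apply: ereal_inf_lbound; exists (F \o f) => //; split.
    move=> x /Acov[k [y yl yx]].
    have [_ _ /(_ (k, index y (L k)) I)[i _ fi]] := bijf.
    exists i => //=; rewrite fi /F /= index_mem yl nth_index//.
    by rewrite ballE_rV.
  move=> i /=; rewrite /F; case: ifP => _.
    by apply: (le_trans (diam_ball_le _ _ (rad0 _))); rewrite lee_fin.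
  by apply: ge_ereal_sup => _ [->|[y []//]]; rewrite lee_fin ltW.
rewrite nneseries_esumT; last by move=> i; exact: F0.
rewrite -(@reindex_esum R _ _ [set: nat] [set: nat * nat] f (fun p => diam_pow s (F p)) bijf).
have -> : [set: nat * nat] = [set: nat] `*`` (fun=> [set: nat]) by apply/seteqP; split.
have -> : \esum_(p in [set: nat] `*`` (fun=> [set: nat])) diam_pow s (F p) =
    \esum_(i in [set: nat]) \esum_(j in [set: nat]) diam_pow s (F (i, j)).
  by rewrite esum_esum//; apply: eq_esum => -[].
rewrite nneseries_esumT; last by move=> k; rewrite lee_fin mulr_ge0 ?powR_ge0.
apply: le_esum => k _.
rewrite -nneseries_esumT; last by move=> j; exact: F0.
rewrite (nneseries_split 0 (size (L k)))//.
rewrite add0n [X in (_ + X)%E]eseries0 ?adde0; last first.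
  by move=> j lj _; rewrite /F/= ltnNge lj/= /diam_pow eqxx.
apply: (@le_trans _ _ (\sum_(0 <= j < size (L k)) ((2 * rad k) `^ s)%:E)%E).
  rewrite big_nat [leRHS]big_nat; apply: lee_sum => j /andP[_ jl].
  by rewrite /F/= jl; exact: diam_pow_ball.
by rewrite sumEFin lee_fin sumr_const_nat subn0 -[leLHS]mulr_natl.
Qed.

Lemma hausdorff_measure_eq0 s (A : set V) :
  (forall rho e : R, 0 < rho -> 0 < e -> (hausdorff_premeasure s rho A <= e%:E)%E) ->
  hausdorff_measure s A = 0%E.
Proof.
move=> H; apply/eqP; rewrite eq_le; apply/andP; split.
  apply: ge_ereal_sup => _ [rho rho0 <-]; apply/lee_addgt0Pr => e e0.
  by rewrite add0e; exact: H.
apply: (@le_trans _ _ (hausdorff_premeasure s 1 A)); last first.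
  by apply: ereal_sup_ubound; exists 1 => //=; exact: ltr01.
apply: le_ereal_inf_tmp => _ [U _ <-]; apply: nneseries_ge0 => i _ _.
exact: diam_pow_ge0.
Qed.

(** With [eta = Q ^ (- t)] the block at [Q] contributes, up to a constant,
    [Q ^ (1 - t * d + (1 + t) * (delta - s))]. The last hypothesis makes this exponent negative, and
    over dyadic [Q] the series is geometric. *)
Lemma hausdorff_measure_W_eq0 mu K (psi : nat -> R) (delta alpha beta Q0 C t s : R)
  (theta : V) :
  (1 <= d)%N -> compact K -> 0 < beta -> 0 < delta -> 1 < Q0 -> regular K mu delta C ->
  counting_bounds K mu delta alpha beta theta Q0 C ->
  d%:R^-1 < t -> t < alpha -> (exists N, forall q, (N <= q)%N -> psi q < q%:R `^ (- t)) ->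
  0 < s -> 0 < t * d%:R - 1 + (1 + t) * (s - delta) ->
  hausdorff_measure s (K `&` W psi theta) = 0%E.
Proof.
move=> d1 cK b0 delta0 Q01 reg cnt dt ta [N HN] s0; set g := _ + _ => g0.
have [C' C'0 HC] := block_cover mu K delta alpha beta Q0 C theta cK b0 delta0 Q01 reg cnt.
apply: hausdorff_measure_eq0 => rho e rho0 e0.
have d0 : 0 < d%:R :> R by rewrite ltr0n.
have dV0 : 0 < d%:R^-1 :> R by rewrite invr_gt0.
have t0 : 0 < t by lra.
have [Q1 Q11 HQ1] : exists2 Q1 : R, 1 <= Q1 & forall Q : R, Q1 <= Q -> Q `^ (-
  (t - d%:R^-1)) <= 2^-1.
  by apply: powR_eventually_small => //; lra.
have [Q2 Q21 HQ2] : exists2 Q1 : R, 1 <= Q1 & forall Q : R, Q1 <= Q -> Q `^ (-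
  (1 + t)) <= rho / 2.
  by apply: powR_eventually_small => //; lra.
have z0 : 0 <= (2 : R) `^ (- g) by exact: powR_ge0.
have z1 : (2 : R) `^ (- g) < 1.
  rewrite powRN invf_lt1 ?powR_gt0//.
  have : (1 : R) `^ g < 2 `^ g by apply: gt0_ltr_powR => //; rewrite ?nnegrE// ltr1n.
  by rewrite powR1.
pose c := C' * 2 `^ s.
have c0 : 0 <= c by rewrite mulr_ge0 ?powR_ge0// ltW.
have [k0 Hk0] := geometric_tail c _ e c0 z0 z1 e0.
pose B := Num.max (Num.max Q0 Q1) (Num.max Q2 N%:R).
have [k1 Hk1] : exists k1, forall k, (k1 <= k)%N -> B <= 2 ^+ k.
  exists (Num.bound B) => k Bk.
  have B0 : 0 <= B by rewrite !le_max ler0n !orbT.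
  apply: (le_trans (ltW (archi_boundP B0))); rewrite -natrX ler_nat.
  by apply: (leq_trans Bk); rewrite ltnW// ltn_expl.
pose n0 := maxn k0 k1.
pose Q k : R := 2 ^+ (n0 + k).
have QB k : B <= Q k by apply: Hk1; rewrite (leq_trans (leq_maxr k0 k1))// leq_addr.
have Qs k : [/\ Q0 <= Q k, Q1 <= Q k, Q2 <= Q k & N%:R <= Q k].
  by have := QB k; rewrite !ge_max => /andP[/andP[-> ->] /andP[-> ->]].
pose eta k := Q k `^ (- t).
have Qg0 k : 0 < Q k by rewrite exprn_gt0.
have Qg1 k : 1 <= Q k by have [? _ _ _] := Qs k; lra.
have eta0 k : 0 < eta k by rewrite powR_gt0.
have blk k : exists l : seq V, K `&` A_ (Q k) (eta k) theta `<=`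
        (fun x => exists2 y, y \in l & `|y - x| < eta k / Q k) /\
      (size l)%:R <= C' * (Q k * eta k ^+ d) * (eta k / Q k) `^ (- delta).
  have [h0 h1 h2 h3] := Qs k.
  apply: HC => //.
    apply: (@le_trans _ _ 1) => //; rewrite -(powRr0 (Q k)) ler_powR//; lra.
  apply/andP; split.
    apply: (@le_trans _ _ (eta k)); first by rewrite ler_powR//; lra.
    by have := eta0 k; lra.
  have -> : eta k = Q k `^ (- (t - d%:R^-1)) * Q k `^ (- d%:R^-1).
    by rewrite -powRDp//; congr (_ `^ _); ring.
  have := HQ1 _ h1; have : 0 < Q k `^ (- d%:R^-1) by rewrite powR_gt0.
  by move=> p0 p1; rewrite mulrA ler_piMl ?(ltW p0)//; lra.
have [L HL] := choice blk.
apply: (@premeasure_cover s rho e _ L (fun k => eta k / Q k)) => //.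
- by move=> k; rewrite divr_gt0.
- move=> k; have [_ _ /HQ2 h _] := Qs k.
  have -> : eta k / Q k = Q k `^ (- (1 + t)).
    rewrite /eta -{2}(powRr1 (ltW (Qg0 k))) -powRN -powRDp//; congr (_ `^ _); ring.
  by lra.
- move=> x [Kx /infinite_nat_unbounded/(_ (2 ^ n0)%N) [q qn]] /= dq.
  have q0 : (0 < q)%N by apply: leq_trans qn; rewrite expn_gt0.
  have /andP[lo hi] := trunc_log_bounds (isT : (1 < 2)%N) q0.
  set m := trunc_log 2 q in lo hi.
  have n0m : (n0 <= m)%N by rewrite -ltnS -(ltn_exp2l _ _ (isT : (1 < 2)%N))
    (leq_ltn_trans qn).
  exists (m - n0)%N; have [HL1 _] := HL (m - n0)%N.
  have Qm : Q (m - n0)%N = (2 ^ m)%:R by rewrite /Q subnKC// natrX.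
  apply: HL1; split => //; exists q; split.
    by rewrite Qm ler_nat lo -natrM -expnS ltr_nat.
  apply: (lt_le_trans dq); apply: (@le_trans _ _ (q%:R `^ (- t))).
    apply/ltW/HN; rewrite -(ler_nat R); apply: (@le_trans _ _ (Q (m - n0)%N)).
      by have [] := Qs (m - n0)%N.
    by rewrite Qm ler_nat.
  rewrite /eta Qm !powRN lef_pV2 ?posrE ?powR_gt0 ?ltr0n ?expn_gt0//.
  by apply: ge0_ler_powR; rewrite ?nnegrE ?ler0n ?ler_nat// ltW.
- have n0k0 : (k0 <= n0)%N by exact: leq_maxl.
  apply: le_trans (Hk0 _ n0k0); apply: lee_nneseries => [k _ _|k _].
    by rewrite lee_fin mulr_ge0 ?powR_ge0.
  rewrite lee_fin; have [_ Lk] := HL k.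
  have ek0 : 0 < eta k / Q k by rewrite divr_gt0.
  rewrite powRM ?(ltW ek0)// /c.
  apply: (@le_trans _ _ (C' * (Q k * eta k ^+ d) * (eta k / Q k) `^ (- delta) *
      (2 `^ s * (eta k / Q k) `^ s))).
    by rewrite ler_wpM2r// mulr_ge0 ?powR_ge0.
  have -> : eta k / Q k = Q k `^ (- (1 + t)).
    rewrite /eta -{2}(powRr1 (ltW (Qg0 k))) -powRN -powRDp//; congr (_ `^ _); ring.
  have -> : Q k * eta k ^+ d = Q k `^ (1 - t * d%:R).
    rewrite /eta -powR_mulrn ?powR_ge0// -powRrM -{1}(powRr1 (ltW (Qg0 k))) -powRDp//.
    by congr (_ `^ _); ring.
  have -> : (2 `^ (- g)) ^+ (n0 + k) = Q k `^ (- g) :> R.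
    by rewrite /Q powR_exprn.
  rewrite -!powRrM.
  rewrite (_ : _ * _ = C' * 2 `^ s * (Q k `^ (1 - t * d%:R) *
     Q k `^ (- (1 + t) * - delta) * Q k `^ (- (1 + t) * s))); last by ring.
  rewrite -!powRDp// le_eqVlt; apply/orP; left; apply/eqP; congr (_ * _ `^ _).
  by rewrite /g; ring.
Qed.

Lemma hausdorff_dim_le s (A : set V) : 0 <= s -> hausdorff_measure s A = 0%E ->
  (hausdorff_dim A <= s%:E)%E.
Proof. by move=> s0 H; apply: ereal_inf_lbound; exists s. Qed.

End upper.

(** * Rational points near a hyperplane *)

Section dirichlet.
Context {R : realType} {d : nat}.
Local Notation V := 'rV[R]_d.

(** Pigeonhole: there are [(H + 1) ^ d] vectors with entries from 0 to [H], and the fractional parts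
    of their values at [y] fall into [H ^ d] intervals. Two vectors sharing an interval have
    difference [a], and their integer parts give [a0]. *)
Lemma dirichlet (y : V) (H : nat) : (1 <= d)%N -> (1 <= H)%N ->
  exists (a0 : int) (a : 'I_d -> int), [/\ exists j, a j != 0,
    forall j, `|(a j)%:~R : R| <= H%:R &
    `|a0%:~R + \sum_j (a j)%:~R * y ord0 j| < (H%:R ^+ d)^-1].
Proof.
move=> d1 H1.
pose N := (H ^ d)%N.
have N0 : (0 < N)%N by rewrite expn_gt0 H1.
have N0R : 0 < N%:R :> R by rewrite ltr0n.
pose F (n : {ffun 'I_d -> 'I_H.+1}) : R := \sum_j (n j)%:R * y ord0 j.
pose g n := F n - (Num.floor (F n))%:~R.
have g01 n : 0 <= g n < 1.
  have /andP[h1 h2] := floor_itv (F n); apply/andP; split; first by rewrite /g; lra.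
  by move: h2; rewrite intrD /g; lra.
pose box n : 'I_N.-1.+1 := inord (Num.truncn (N%:R * g n)).
have Ng n : 0 <= N%:R * g n < N%:R.
  by have /andP[g0 g1] := g01 n; rewrite mulr_ge0//= gtr_pMr.
have boxE n : (box n : nat) = Num.truncn (N%:R * g n).
  rewrite /box inordK// prednK// -(ltr_nat R).
  have /andP[h0 h1] := Ng n; apply: le_lt_trans h1.
  by have /andP[] := truncn_itv h0.
have : ~ injective box.
  move=> /leq_card; rewrite card_ffun !card_ord prednK// leqNgt ltn_exp2r// ltnSn//.
move=> /existsNP[n /existsNP[n' /not_implyP[bnn nn']]].
exists (Num.floor (F n') - Num.floor (F n)), (fun j => (n j : int) - (n' j : int)); split.
- apply: contrapT => /forallNP h; apply: nn'; apply/ffunP => j; apply/val_inj.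
  by have /negP := h j; rewrite negbK subr_eq0 => /eqP[].
- move=> j; rewrite intrD intrN -!pmulrn.
  have : (n j <= H)%N by rewrite -ltnS.
  have : (n' j <= H)%N by rewrite -ltnS.
  rewrite -!(ler_nat R) => h1 h2; rewrite ler_norml.
  have : 0 <= (n j)%:R :> R by []. have : 0 <= (n' j)%:R :> R by [].
  by move=> h3 h4; apply/andP; split; lra.
have -> : (Num.floor (F n') - Num.floor (F n))%:~R +
    \sum_j ((n j : int) - (n' j : int))%:~R * y ord0 j = g n - g n'.
  rewrite intrD intrN /g.
  have -> : \sum_j ((n j : int) - (n' j : int))%:~R * y ord0 j = F n - F n'.
    rewrite /F -sumrB; apply: eq_bigr => j _.
    by rewrite intrD intrN -!pmulrn mulrBl.
  by lra.
have e : Num.truncn (N%:R * g n) = Num.truncn (N%:R * g n') by rewrite -!boxE bnn.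
have /andP[h0 _] := Ng n; have /andP[h0' _] := Ng n'.
have := truncn_itv h0; have := truncn_itv h0'; rewrite -e.
move: (Num.truncn _) => k; rewrite -!(natr1 k) => /andP[k1 k2] /andP[k3 k4].
rewrite -natrX -/N -[ltRHS]mul1r ltr_pdivlMr// mulrC -{1}(ger0_norm (ltW N0R)) -normrM.
rewrite mulrBr ltr_norml; apply/andP; split; lra.
Qed.

(** The bound [4 * Q <= H ^ d] makes [q / H ^ d < 1 / 2] for [q < 2 * Q]; the constant 5 is 4, from
    [4 ^ (1 / d)], plus 1 for rounding. *)
Lemma dirichlet_height (Q : R) : (1 <= d)%N -> 1 <= Q ->
  exists H : nat, [/\ (1 <= H)%N, 4 * Q <= H%:R ^+ d & H%:R <= 5 * Q `^ (d%:R^-1)].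
Proof.
move=> d1 Q1.
have d0 : 0 < d%:R :> R by rewrite ltr0n.
have dV : d%:R^-1 <= 1 :> R by rewrite invf_le1// ler1n.
have dV0 : 0 < d%:R^-1 :> R by rewrite invr_gt0.
pose t := (4 * Q) `^ (d%:R^-1).
have t0 : 0 <= t by exact: powR_ge0.
exists (Num.truncn t).+1; split => //.
  have /andP[_ h] := truncn_itv t0.
  apply: (@le_trans _ _ (t ^+ d)); last by rewrite ler_pXn2r ?nnegrE// ltW.
  by rewrite -powR_mulrn// /t -powRrM mulVf ?gt_eqF// powRr1// mulr_ge0//; lra.
have /andP[h _] := truncn_itv t0.
rewrite -natr1.
have : t <= 4 * Q `^ (d%:R^-1).
  rewrite /t powRM//; last by lra.
  rewrite ler_wpM2r ?powR_ge0// -[leRHS]powRr1// ler_powR//; lra.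
have := @ler_powR R Q Q1 0 d%:R^-1 (ltW dV0); rewrite powRr0.
lra.
Qed.

(** An integral linear form that is small at [x] takes at a nearby rational point [p / q] a value
    which, times [q], is an integer of modulus below 1. So it vanishes there, and all these points
    lie on one hyperplane. Integrality uses [theta = 0]. *)
Lemma near_hyperplane (x : V) (Q eta r : R) : (1 <= d)%N -> 1 <= Q ->
  0 < eta -> eta <= Q * r -> r <= (30 * d%:R)^-1 * Q `^ (- (1 + d%:R^-1)) ->
  exists (j0 : 'I_d) (b0 : R) (b : 'I_d -> R), [/\ b j0 = 1, forall j, `|b j| <= 1 &
    forall y, ball x r y -> A_ Q eta 0 y ->
      `|b0 + \sum_j b j * y ord0 j| <= d%:R * (eta / Q)].
Proof.
move=> d1 Q1 eta0 etaQr rle.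
have d0 : 0 < d%:R :> R by rewrite ltr0n.
have Q0 : 0 < Q by lra.
have [H [H1 HQ HQ']] := dirichlet_height _ d1 Q1.
have [a0 [a [[j1 aj1] aH a0a]]] := dirichlet x H d1 H1.
have H0 : 0 < H%:R :> R by rewrite ltr0n.
(* Dividing by the largest coefficient bounds the others by 1 and allows solving for coordinate
   [j0]. *)
pose j0 := [arg max_(j > j1) `|a j|%N].
have j0max j : `|(a j)%:~R : R| <= `|(a j0)%:~R|.
  rewrite /j0; case: arg_maxnP => // i _ /(_ j isT) h.
  by rewrite -!intr_norm ler_int -!abszE lez_nat.
have aj0 : 0 < `|(a j0)%:~R : R|.
  by apply: lt_le_trans (j0max j1); rewrite normr_gt0 intr_eq0.
have aj0' : (a j0)%:~R != 0 :> R by rewrite -normr_gt0.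
exists j0, (a0%:~R / (a j0)%:~R), (fun j => (a j)%:~R / (a j0)%:~R); split.
- by rewrite divff.
- by move=> j; rewrite normf_div ler_pdivrMr// mul1r.
move=> y; rewrite ballE_rV => xy [q [/andP[Qq qQ] /dist_int_ltP[p]]].
rewrite subr0 => qyp.
have q0 : 0 < q%:R :> R by lra.
have sum_le (v : V) e : `|v| <= e -> `|\sum_j
  (a j)%:~R * v ord0 j| <= d%:R * `|(a j0)%:~R : R| * e.
  move=> ve; apply: (le_trans (ler_norm_sum _ _ _)).
  apply: (@le_trans _ _ (\sum_(j < d) `|(a j0)%:~R : R| * e)).
    apply: ler_sum => j _; rewrite normrM ler_pM//.
    exact: le_trans (coord_le_norm _ _) ve.
  by rewrite sumr_const card_ord -[leLHS]mulr_natl mulrA.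
have lin (v w : V) : \sum_j (a j)%:~R * (v - w) ord0 j =
    \sum_j (a j)%:~R * v ord0 j - \sum_j (a j)%:~R * w ord0 j.
  by rewrite -sumrB; apply: eq_bigr => j _; rewrite !mxE mulrBr.
have linZ c (v : V) : \sum_j (a j)%:~R * (c *: v) ord0 j = c * \sum_j (a j)%:~R * v ord0 j.
  by rewrite big_distrr/=; apply: eq_bigr => j _; rewrite !mxE mulrCA.
pose z : int := a0 * (q : int) + \sum_j a j * p ord0 j.
have zE : z%:~R = a0%:~R * q%:R + \sum_j (a j)%:~R * (map_mx intr p : V) ord0 j.
  rewrite /z intrD intrM -pmulrn; congr (_ + _).
  by rewrite rmorph_sum/=; apply: eq_bigr => j _; rewrite intrM mxE.
have qxp : `|q%:R *: x - map_mx intr p| <= 3 * (Q * r).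
  have -> : q%:R *: x - map_mx intr p = q%:R *: (x - y) + (q%:R *: y - map_mx intr p).
    by rewrite scalerBr subrKA.
  have := ler_normD (q%:R *: (x - y)) (q%:R *: y - map_mx intr p).
  rewrite normrZ (ger0_norm (ltW q0)).
  have : q%:R * `|x - y| <= 2 * Q * r by rewrite ler_pM// ltW.
  lra.
(* [z] is an integer of absolute value less than 1. *)
have z0 : z = 0.
  have zlt : `|z%:~R : R| < 1.
    have -> : z%:~R = q%:R * (a0%:~R + \sum_j (a j)%:~R * x ord0 j) -
        \sum_j (a j)%:~R * (q%:R *: x - map_mx intr p) ord0 j.
      by rewrite zE lin linZ; ring.
    apply: (le_lt_trans (ler_normB _ _)); rewrite normrM (ger0_norm (ltW q0)).
    (* Two halves: here [q < 2 * Q] meets [4 * Q <= H ^ d]; below, [d * 5 * 3 / (30 * d) = 1 / 2],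
       the origin of the constant 30. *)
    have h1 : q%:R * `|a0%:~R + \sum_j (a j)%:~R * x ord0 j| < 2^-1.
      apply: (@le_lt_trans _ _ (q%:R * (H%:R ^+ d)^-1)).
        by rewrite ler_wpM2l// ltW.
      by rewrite ltr_pdivrMr ?exprn_gt0//; lra.
    have h2 : `|\sum_j (a j)%:~R * (q%:R *: x - map_mx intr p) ord0 j| <= 2^-1.
      apply: (le_trans (sum_le _ _ qxp)).
      apply: (@le_trans _ _ (d%:R * (5 * Q `^ d%:R^-1) *
          (3 * (Q * ((30 * d%:R)^-1 * Q `^ (- (1 + d%:R^-1))))))).
        have Qr0 : 0 <= Q * r by exact: le_trans (ltW eta0) etaQr.
        have h3 : d%:R * `|(a j0)%:~R : R| <= d%:R * (5 * Q `^ d%:R^-1).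
          by apply: ler_wpM2l => //; apply: le_trans HQ'.
        have h4 : 3 * (Q * r) <= 3 * (Q * ((30 * d%:R)^-1 * Q `^ (- (1 + d%:R^-1)))).
          by apply: ler_wpM2l => //; apply: ler_wpM2l => //; exact: ltW.
        by apply: ler_pM h3 h4; rewrite mulr_ge0.
      have -> : Q `^ (- (1 + d%:R^-1)) = (Q * Q `^ d%:R^-1)^-1.
        by rewrite powRN powRDp// powRr1// ltW.
      have Qd0 : 0 < Q `^ d%:R^-1 by rewrite powR_gt0.
      move: Qd0; set w := Q `^ _ => w0.
      rewrite le_eqVlt; apply/orP; left; apply/eqP; field.
      by rewrite !gt_eqF.
    lra.
  move: zlt; rewrite -intr_norm ltrz1 -abszE ltz_nat ltnS leqn0 absz_eq0.
  by move/eqP.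
have e1 : a0%:~R + \sum_j (a j)%:~R * y ord0 j =
    (\sum_j (a j)%:~R * (q%:R *: y - map_mx intr p) ord0 j) / q%:R.
  rewrite lin linZ; move: zE; rewrite z0 => /eqP; rewrite eq_sym addr_eq0 => /eqP h.
  rewrite -[X in _ - X]opprK -h mulrDl mulrC mulKf ?gt_eqF// addrC; congr (_ + _).
  by rewrite opprK mulfK ?gt_eqF.
have -> : a0%:~R / (a j0)%:~R + \sum_j (a j)%:~R / (a j0)%:~R * y ord0 j =
   (a0%:~R + \sum_j (a j)%:~R * y ord0 j) / (a j0)%:~R.
  by rewrite mulrDl big_distrl/=; congr (_ + _); apply: eq_bigr => j _; rewrite mulrAC.
rewrite e1 !normf_div (ger0_norm (ltW q0)) ler_pdivrMr// ler_pdivrMr//.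
apply: (le_trans (sum_le _ _ (ltW qyp))).
rewrite (_ : _ * q%:R = d%:R * `|(a j0)%:~R : R| * (eta * (q%:R / Q))); last by ring.
rewrite ler_wpM2l ?mulr_ge0// ler_peMr ?(ltW eta0)// ler_pdivlMr//; lra.
Qed.

End dirichlet.

(** * Mass of the approximation set in a thin slab *)

Lemma pairwise_mem (T : eqType) (r : rel T) (l : seq T) :
  (forall y z, r y z = r z y) -> pairwise r l ->
  {in l &, forall y z, y != z -> r y z}.
Proof.
move=> rC; elim: l => [//|x l ih] /= /andP[/allP xl /ih pl] y z.
rewrite !inE => /predU1P[->|yl] /predU1P[->|zl]; rewrite ?eqxx// => yz.
- exact: xl.
- by rewrite rC; exact: xl.
- exact: pl.
Qed.

Section slab.
Context {R : realType} {d : nat}.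
Local Notation V := 'rV[R]_d.
Implicit Types (mu : probability (borel_rV R d) R) (K S : set V).

Lemma cover_measure mu K S (l : seq V) (t b : R) :
  measurable (K : set (borel_rV R d)) -> mu K = 1%E ->
  measurable (S : set (borel_rV R d)) ->
  (forall x, S x -> K x -> exists2 y, y \in l & `|y - x| < t) ->
  (forall y, y \in l -> (mu (ball y t `&` S) <= b%:E)%E) ->
  (mu S <= ((size l)%:R * b)%:E)%E.
Proof.
move=> mK muK mS cov bnd; rewrite -(probability_setIK _ _ _ mK muK mS).
pose W (l : seq V) := \bigcup_(y in [set y | y \in l]) (ball y t `&` S).
have mBS y : measurable (ball y t `&` S : set (borel_rV R d)).
  by apply: measurableI => //; exact: measurable_ball_rV.
have WS y l' : W (y :: l') = (ball y t `&` S) `|` W l'.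
  apply/seteqP; split => x.
    move=> [z /=]; rewrite inE => /predU1P[->|zl] zx; [by left|by right; exists z].
  move=> [yx|[z zl zx]]; first by exists y => //=; rewrite inE eqxx.
  by exists z => //=; rewrite inE zl orbT.
have W0 : W [::] = set0 by rewrite -subset0 => x [].
have mW l' : measurable (W l' : set (borel_rV R d)).
  by elim: l' => [|y l' ih]; [rewrite W0|rewrite WS; exact: measurableU].
apply: (@le_trans _ _ (mu (W l))).
  apply: le_mu => //; first exact: measurableI.
  move=> x [Sx Kx]; have [y yl yx] := cov x Sx Kx.
  by exists y => //; split => //; rewrite ballE_rV.
elim: l bnd {cov} => [|y l ih] bnd; first by rewrite W0 measure0 mul0r.
rewrite WS; apply: (le_trans (measureU2 _ (mBS y) (mW l))).
rewrite /= -(natr1 (size l)) mulrDl mul1r [_ * b + b]addrC EFinD; apply: leeD.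
  by apply: bnd; rewrite inE eqxx.
by apply: ih => z zl; apply: bnd; rewrite inE zl orbT.
Qed.

Lemma hyperplane_coord (j0 : 'I_d) (b0 : R) (b : 'I_d -> R) (y z : V) (e : R) :
  b j0 = 1 -> (forall j, `|b j| <= 1) -> 0 <= e ->
  `|b0 + \sum_j b j * y ord0 j| <= d%:R * e ->
  `|b0 + \sum_j b j * z ord0 j| <= d%:R * e ->
  (forall j, j != j0 -> `|(y - z) ord0 j| <= e) ->
  `|y - z| <= 3 * d%:R * e.
Proof.
move=> bj0 b1 e0 hy hz hj.
have d1 : 1 <= d%:R :> R by rewrite ler1n (leq_ltn_trans _ (ltn_ord j0)).
apply: norm_rV_le; first by rewrite !mulr_ge0//; lra.
move=> j; have [->|/hj h] := eqVneq j j0; last first.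
  by apply: (le_trans h); rewrite ler_peMl//; lra.
have -> : (y - z) ord0 j0 = (b0 + \sum_j b j * y ord0 j) - (b0 + \sum_j b j * z ord0 j)
   - \sum_(j | j != j0) b j * (y - z) ord0 j.
  rewrite opprD addrACA subrr add0r -sumrB.
  under eq_bigr do rewrite -mulrBr.
  rewrite (bigD1 j0)//= bj0 mul1r.
  have -> : \sum_(i < d | i != j0) b i * (y ord0 i - z ord0 i) =
            \sum_(i < d | i != j0) b i * (y - z) ord0 i.
    by apply: eq_bigr => i _; rewrite !mxE.
  by rewrite addrK !mxE.
have hs : `|\sum_(j | j != j0) b j * (y - z) ord0 j| <= d%:R * e.
  apply: (le_trans (ler_norm_sum _ _ _)).
  apply: (@le_trans _ _ (\sum_(j < d) e)); last first.
    by rewrite sumr_const card_ord -[leLHS]mulr_natl.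
  rewrite [leRHS](bigD1 j0)//= -[leLHS]add0r lerD//.
  apply: ler_sum => i ij; rewrite normrM -[e]mul1r ler_pM//.
  exact: hj.
set X := b0 + _ in hy *; set Y := b0 + _ in hz *; set Z := \sum_(_ | _) _ in hs *.
have := ler_normB (X - Y) Z; have := ler_normB X Y.
lra.
Qed.

(** The coordinates other than [j0] are sorted into cells of side [e]. Slab points in one cell are
    within [3 * d * e], less than the separation [4 * d * e], so a cell holds at most one. *)
Lemma separated_slab (x : V) (r e : R) (j0 : 'I_d) (b0 : R) (b : 'I_d -> R) (l : seq V) :
  b j0 = 1 -> (forall j, `|b j| <= 1) -> 0 < e -> e <= r ->
  (forall y, y \in l -> `|x - y| < r /\ `|b0 + \sum_j b j * y ord0 j| <= d%:R * e) ->
  pairwise (fun y z => 4 * d%:R * e <= `|y - z|) l ->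
  (size l)%:R <= (3 * (r / e)) ^+ d.-1.
Proof.
move=> bj0 b1 e0 er lS pl.
have d1 : 1 <= d%:R :> R by rewrite ler1n (leq_ltn_trans _ (ltn_ord j0)).
have re1 : 1 <= r / e by rewrite ler_pdivlMr// mul1r.
pose M := Num.truncn (2 * (r / e)).
pose t (y : V) (k : 'I_d.-1) := (y ord0 (lift j0 k) - x ord0 (lift j0 k) + r) / e.
pose cell (y : V) : {ffun 'I_d.-1 -> 'I_M.+1} := [ffun k => inord (Num.truncn (t y k))].
have tb y k : `|x - y| < r -> 0 <= t y k <= 2 * (r / e).
  move=> xy; have := le_lt_trans (coord_le_norm (x - y) (lift j0 k)) xy.
  rewrite !mxE ltr_norml => /andP[h1 h2]; rewrite /t mulrA.
  by rewrite divr_ge0 ?(ltW e0)//= ?ler_pM2r ?invr_gt0//; lra.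
have cellE y k : `|x - y| < r -> (cell y k : nat) = Num.truncn (t y k).
  move=> xy; rewrite ffunE inordK// ltnS; have /andP[_] := tb y k xy.
  exact: le_truncn.
have cell_inj : {in l &, injective cell}.
  move=> y z yl zl cyz; have [xy hy] := lS _ yl; have [xz hz] := lS _ zl.
  have yz : `|y - z| <= 3 * d%:R * e.
    apply: (hyperplane_coord j0 b0 b) => //; first exact: ltW.
    move=> j; rewrite eq_sym => /unlift_some[k -> _].
    have /andP[h1 _] := tb y k xy; have /andP[h2 _] := tb z k xz.
    have := truncn_itv h1; have := truncn_itv h2.
    rewrite -!cellE// cyz; move: (cell z k : nat) => n.
    rewrite -(natr1 n) => /andP[k1 k2] /andP[k3 k4].
    have : `|t y k - t z k| <= 1 by rewrite ler_norml; apply/andP; split; lra.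
    rewrite /t -mulrBl normrM (gtr0_norm (_ : 0 < e^-1)) ?invr_gt0// ler_pdivrMr// mul1r.
    by rewrite opprD addrACA subrr addr0 opprB addrA subrK !mxE.
  have [//|yz'] := eqVneq y z; exfalso.
  have : 4 * d%:R * e <= `|y - z|.
    apply: (@pairwise_mem _ (fun u v : V => 4 * d%:R * e <= `|u - v|) l _ pl y z yl zl yz').
    by move=> u v; rewrite distrC.
  have : 0 < d%:R * e by rewrite mulr_gt0//; lra.
  by lra.
have ul : uniq l.
  apply: pairwise_uniq pl => y; rewrite subrr normr0; apply/negbTE.
  by rewrite -ltNge !mulr_gt0//; lra.
have : (size l <= M.+1 ^ d.-1)%N.
  rewrite -(size_map cell); apply: (@leq_trans #|{ffun 'I_d.-1 -> 'I_M.+1}|); last first.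
    by rewrite card_ffun !card_ord.
  have /card_uniqP <- : uniq (map cell l) by rewrite map_inj_in_uniq.
  exact: max_card.
rewrite -(ler_nat R) natrX => /le_trans; apply.
have h0 : 0 <= 2 * (r / e) by lra.
have /andP[h _] := truncn_itv h0.
rewrite lerXn2r ?nnegrE//; first by lra.
rewrite -natr1; move: h; rewrite -/M; lra.
Qed.

Lemma slab_measure mu K (delta C Q eta r : R) (x : V) :
  (1 <= d)%N -> compact K -> mu K = 1%E -> regular K mu delta C -> 0 < delta ->
  1 <= Q -> 0 < eta -> eta <= Q * r -> 2 * d%:R * (eta / Q) <= 1 ->
  r <= (30 * d%:R)^-1 * Q `^ (- (1 + d%:R^-1)) ->
  (mu (ball x r `&` A_ Q eta 0) <= ((3 * (r / (eta / Q))) ^+ d.-1 *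
      (C * (4 * d%:R * (eta / Q)) `^ delta))%:E)%E.
Proof.
move=> d1 cK muK reg delta0 Q1 eta0 etaQr eQ rle.
have d0 : 1 <= d%:R :> R by rewrite ler1n.
have Q0 : 0 < Q by lra.
have mK := compact_measurable_rV _ cK.
have [C1 upb _] := reg.
pose e := eta / Q; rewrite -/e in eQ *.
have e0 : 0 < e by rewrite divr_gt0.
have er : e <= r by rewrite ler_pdivrMr// mulrC.
have d00 : 0 < d%:R :> R by lra.
have de0 : 0 < 2 * d%:R * e by apply: mulr_gt0 => //; exact: mulr_gt0.
have [j0 [b0 [b [bj0 b1 hb]]]] := @near_hyperplane R d x Q eta r d1 Q1 eta0 etaQr rle.
have mS : measurable (ball x r `&` A_ Q eta 0 : set (borel_rV R d)) by exact: measurable_ballA.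
have [l [lS pl cl]] := @packing_cover R d K mu delta C (K `&` (ball x r `&` A_ Q eta 0))
   (2 * d%:R * e) reg de0 eQ (@subIsetl _ _ _).
have twice : 2 * (2 * d%:R * e) = 4 * d%:R * e by ring.
rewrite twice in pl cl.
have lS' y : y \in l -> `|x - y| < r /\ `|b0 + \sum_j b j * y ord0 j| <= d%:R * e.
  move=> /lS[_ [xy Ay]]; split; last exact: hb.
  by rewrite ballE_rV in xy.
have sl := separated_slab x r e j0 b0 b l bj0 b1 e0 er lS' pl.
apply: (@le_trans _ _ ((size l)%:R * (C * (4 * d%:R * e) `^ delta))%:E).
  apply: (@cover_measure mu K _ l (4 * d%:R * e)) => //.
    by move=> y Sy Ky; apply: cl.
  move=> y yl; apply: (@le_trans _ _ (mu (ball y (4 * d%:R * e)))).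
    apply: le_mu; [|exact: measurable_ball_rV|exact: subIsetl].
    by apply: measurableI => //; exact: measurable_ball_rV.
  apply: upb; first by have [] := lS _ yl.
  by lra.
rewrite lee_fin ler_wpM2r// mulr_ge0 ?powR_ge0//; lra.
Qed.

(** A net of [ball x r] at scale [t / 2] has disjoint balls inside [ball x (2 * r)]. The two sides
    of regularity give [C ^ 2], and [2 * r] over [t / 2] gives the 4. *)
Lemma ball_cover_measure mu K S (delta C r t B : R) (x : V) :
  compact K -> mu K = 1%E -> regular K mu delta C -> 0 < delta -> K x ->
  measurable (S : set (borel_rV R d)) -> 0 < t -> t <= 1 -> t <= r ->
  (forall y, K y -> (mu (ball y t `&` S) <= B%:E)%E) ->
  (mu (ball x r `&` S) <= (C ^+ 2 * 4 `^ delta * (r / t) `^ delta * B)%:E)%E.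
Proof.
move=> cK muK reg delta0 Kx mS t0 t1 tr bnd.
have mK := compact_measurable_rV _ cK.
have [C1 upb lowb] := reg.
have C0 : 0 < C by lra.
have t20 : 0 < t / 2 by lra.
have t21 : t / 2 <= 1 by lra.
have r0 : 0 < r by lra.
have [l [lS pl cl]] := @packing_cover R d K mu delta C (K `&` ball x r) (t / 2) reg t20 t21
  (@subIsetl _ _ _).
have tt : 2 * (t / 2) = t by rewrite mulrC divfK.
have lK y : y \in l -> K y by move=> /lS[].
have lB y : y \in l -> ball y (t / 2) `<=` ball x (2 * r).
  move=> /lS[_]; rewrite ballE_rV => xy z; rewrite !ballE_rV => yz.
  have -> : x - z = (x - y) + (y - z) by rewrite subrKA.
  by have := ler_normD (x - y) (y - z); lra.
have := packing_measure K mu delta C l (t / 2) (ball x (2 * r)) reg t20 t21 lK pl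
  (measurable_ball_rV _ _) lB.
have r20 : 0 < 2 * r by lra.
move=> /le_trans/(_ (upb _ _ Kx r20)); rewrite lee_fin => sl.
have B0 : 0 <= B.
  by have := le_trans (measure_ge0 mu _) (bnd x Kx); rewrite lee_fin.
apply: (@le_trans _ _ ((size l)%:R * B)%:E).
  apply: (@cover_measure mu K _ l t) => //.
  - by apply: measurableI => //; exact: measurable_ball_rV.
  - by move=> y [xy _] Ky; have := cl y (conj Ky xy); rewrite tt.
  move=> y yl; apply: le_trans (bnd _ (lK _ yl)).
  apply: le_mu.
  + by apply: measurableI; [exact: measurable_ball_rV|apply: measurableI => //;
    exact: measurable_ball_rV].
  + by apply: measurableI => //; exact: measurable_ball_rV.
  + by move=> z [? []].
rewrite lee_fin ler_wpM2r//.
have td0 : 0 < (t / 2) `^ delta by rewrite powR_gt0.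
have ctd : 0 < C^-1 * (t / 2) `^ delta by rewrite mulr_gt0 ?invr_gt0.
move: sl; rewrite -ler_pdivlMr// => /le_trans; apply.
rewrite le_eqVlt; apply/orP; left; apply/eqP.
have -> : 2 * r = 4 * (r / t) * (t / 2) by field; rewrite gt_eqF.
rewrite powRM ?(ltW t20)//; last by rewrite mulr_ge0// divr_ge0// ltW.
rewrite [(4 * (r / t)) `^ _]powRM//; last by rewrite divr_ge0// ltW.
by field; rewrite !gt_eqF.
Qed.

End slab.

(** * Lower bounds for the Hausdorff measure *)

Section lower.
Context {R : realType} {d : nat}.
Local Notation V := 'rV[R]_d.
Implicit Types (mu : probability (borel_rV R d) R) (K S : set V).

(** A negative [s] is allowed because the exponent of the last claim can be negative; on nonempty
    sets of diameter at most 1 the weight is then at least 1, possibly [+oo]. *)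
Lemma diam_pow_mono s s' (A : set V) : s <= s' -> 0 < s' -> (diam A <= 1)%E ->
  (diam_pow s' A <= diam_pow s A)%E.
Proof.
move=> ss s'0; rewrite /diam_pow [s' < 0]ltNge (ltW s'0)/=; case: ifP => // _.
have := diam_ge0 A; case: (diam A) => [D| |]//; rewrite !lee_fin => D0 D1.
rewrite !poweR_EFin; case: ltP => s0; last by rewrite lee_fin powR_dec// D0.
have ND e : 0 <= e -> D `^ e <= 1.
  by move=> e0; rewrite -(powRr0 D) powR_dec ?D0.
rewrite inver; case: eqP => // /eqP DN; rewrite ?leey// lee_fin.
have DNs : 0 < D `^ (- s) by rewrite lt_neqAle eq_sym DN powR_ge0.
apply: (le_trans (ND _ (ltW s'0))); rewrite invf_ge1//.
by apply: ND; rewrite oppr_ge0 ltW.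
Qed.

Lemma hausdorff_measure_mono s s' (A : set V) : s <= s' -> 0 < s' ->
  (hausdorff_measure s' A <= hausdorff_measure s A)%E.
Proof.
move=> ss s'0; apply: ge_ereal_sup => _ [rho rho0 <-].
pose r1 := Num.min rho 1.
apply: (@le_trans _ _ (hausdorff_premeasure s r1 A)); last first.
  by apply: ereal_sup_ubound; exists r1 => //=; rewrite lt_min rho0 ltr01.
apply: le_ereal_inf_tmp => _ [U [cov dU] <-].
apply: (@le_trans _ _ (\sum_(0 <= i <oo) diam_pow s' (U i))%E).
  apply: ereal_inf_lbound; exists U => //; split => // i.
  by apply: (le_trans (dU i)); rewrite lee_fin ge_min lexx.
apply: lee_nneseries => [i _ _|i _]; first exact: diam_pow_ge0.
apply: diam_pow_mono => //; apply: (le_trans (dU i)).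
by rewrite lee_fin ge_min lexx orbT.
Qed.

Lemma hausdorff_dim_ge s (A : set V) : hausdorff_measure s A = +oo%E ->
  (s%:E <= hausdorff_dim A)%E.
Proof.
move=> Hs; apply: le_ereal_inf_tmp => _ [t [t0 Ht] <-]; rewrite lee_fin leNgt.
apply/negP => ts.
have := @hausdorff_measure_mono t s A (ltW ts); rewrite Ht Hs.
by move=> /(_ (le_lt_trans t0 ts)); rewrite leye_eq.
Qed.

(** Counting handles whole blocks of denominators, so a bound at single [q] must be spread out. For
    decreasing [psi] the block ending at [q] serves, with [Q = q / 2]; for increasing [psi] one
    positive value bounds all later ones from below. *)
Lemma monotone_large (psi : nat -> R) (t c : R) :
  nonincreasing_seq psi \/ nondecreasing_seq psi -> 0 < t -> 0 < c ->
  (forall N, exists2 q, (N <= q)%N & c * q%:R `^ (- t) <= psi q) ->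
  exists2 c' : R, 0 < c' & forall B : R, exists2 Q : R, B <= Q &
    forall q : nat, Q <= q%:R -> q%:R < 2 * Q -> c' * Q `^ (- t) <= psi q.
Proof.
move=> mono t0 c0 H; case: mono => mono.
  exists (c * 2 `^ (- t)); first by rewrite mulr_gt0 ?powR_gt0.
  move=> B; have [q qB hq] := H (Num.bound (2 * `|B|)).
  have hB := archi_boundP (mulr_ge0 (ler0n R 2) (normr_ge0 B)).
  have qB' : (Num.bound (2 * `|B|))%:R <= q%:R :> R by rewrite ler_nat.
  exists (q%:R / 2).
    by have := ler_norm B; lra.
  move=> p _; rewrite mulrC divfK// ltr_nat => pq.
  apply: le_trans (mono _ _ (ltnW pq)); apply: le_trans hq.
  by rewrite -mulrA -powRM// ?divr_ge0// [2 * _]mulrC divfK.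
have [q q1 hq] := H 1%N.
have p0 : 0 < psi q by apply: lt_le_trans hq; rewrite mulr_gt0 ?powR_gt0 ?ltr0n.
exists (psi q) => // B; exists (Num.max B q%:R); first by rewrite le_max lexx.
move=> p; rewrite ge_max ler_nat => /andP[_ qp] _.
apply: le_trans (mono _ _ qp); rewrite ler_piMr ?(ltW p0)//.
rewrite -[leRHS](powRr0 (Num.max B q%:R)) ler_powR//; last by lra.
by rewrite le_max ler1n q1 orbT.
Qed.

Lemma W_unbounded (psi : nat -> R) (theta : V) : W psi theta =
  [set x | forall N, exists2 q, (N <= q)%N & dist_int (q%:R *: x - theta) < psi q].
Proof. by apply/seteqP; split => x /infinite_nat_unbounded. Qed.

Lemma eventually_range (alpha t c : R) : d%:R^-1 < t -> t < alpha -> 0 < c ->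
  exists2 Q1 : R, 1 <= Q1 & forall Q : R, Q1 <= Q ->
    Q `^ (- alpha) <= c * Q `^ (- t) <= Q `^ (- d%:R^-1).
Proof.
move=> dt ta c0.
have e1 : 0 < alpha - t by lra.
have e2 : 0 < t - d%:R^-1 by lra.
have [Qa Qa1 Ha] := powR_large (alpha - t) c^-1 e1.
have cV : 0 < c^-1 by rewrite invr_gt0.
have [Qb Qb1 Hb] := powR_eventually_small (t - d%:R^-1) c^-1 e2 cV.
exists (Num.max Qa Qb); first by rewrite le_max Qa1.
move=> Q; rewrite ge_max => /andP[QQa QQb].
have Qg0 : 0 < Q by lra.
apply/andP; split.
  have -> : Q `^ (- alpha) = (Q `^ (alpha - t))^-1 * Q `^ (- t).
    by rewrite -powRN -powRDp//; congr (_ `^ _); ring.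
  rewrite ler_wpM2r ?powR_ge0// -[leRHS]invrK lef_pV2 ?posrE ?powR_gt0//.
  exact: Ha.
have -> : c * Q `^ (- t) = c * Q `^ (- (t - d%:R^-1)) * Q `^ (- d%:R^-1).
  by rewrite -mulrA -powRDp//; congr (_ * _ `^ _); ring.
rewrite ler_piMl ?powR_ge0// mulrC -ler_pdivlMr// mul1r.
exact: Hb.
Qed.

(** Counting covers radii above [Q ^ (- beta)], the last hypothesis those below. The factor 2 before
    [c] is there because points within [eta / (2 * Q)] of [A_ Q eta theta] are only known to lie in
    [A_ Q (2 * eta) theta]. *)
Lemma hausdorff_W_infty mu K (psi : nat -> R) (delta alpha beta Q0 C t c s : R) (theta : V) :
  (1 <= d)%N -> compact K -> mu K = 1%E -> 0 < beta -> beta < 1 -> 0 < s -> s < delta ->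
  1 < Q0 -> regular K mu delta C -> counting_bounds K mu delta alpha beta theta Q0 C ->
  d%:R^-1 < t -> t < alpha -> 0 < c ->
  (forall B : R, exists2 Q : R, B <= Q &
    forall q : nat, Q <= q%:R -> q%:R < 2 * Q -> 2 * c * Q `^ (- t) <= psi q) ->
  (exists Q1 C1 : R, 0 < C1 /\ forall Q x r, Q1 <= Q -> K x ->
    c * Q `^ (- t) / (2 * Q) <= r -> r <= Q `^ (- beta) ->
    (mu (ball x r `&` A_ Q (c * Q `^ (- t)) theta) <=
       (C1 * (Q * (c * Q `^ (- t)) ^+ d) * r `^ s)%:E)%E) ->
  hausdorff_measure s (K `&` W psi theta) = +oo%E.
Proof.
move=> d1 cK muK b0 b1 s0 sd Q01 reg cnt dt ta c0 Hpsi [Q1 [C1 [C10 H1]]].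
have [Cge1 _ _] := reg.
have d0 : 0 < d%:R :> R by rewrite ltr0n.
have dV0 : 0 < d%:R^-1 :> R by rewrite invr_gt0.
have t0 : 0 < t by lra.
have Cx1 : 1 <= C + C1 by lra.
rewrite W_unbounded.
apply: (@hausdorff_limsup R d mu K
  (fun q => [set x | dist_int (q%:R *: x - theta) < psi q]) delta s (C + C1)) => //.
move=> e N e0.
have e3 : 0 < 1 + t - beta by lra.
have cV : 0 < c^-1 by rewrite invr_gt0.
have [Qr Qr1 Hr] := eventually_range alpha t c dt ta c0.
have [Qc Qc1 Hc] := powR_eventually_small (1 + t - beta) c^-1 e3 cV.
have [Qd Qd1 Hd] := powR_eventually_small beta e b0 e0.
have [Q QB HQ] := Hpsi (Num.max (Num.max Q0 Q1)
  (Num.max Qr (Num.max (Num.max Qc Qd) N%:R))).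
move: QB; rewrite !ge_max -!andbA.
move=> /andP[QQ0 /andP[QQ1 /andP[QQr /andP[QQc /andP[QQd QN]]]]].
have Qg0 : 0 < Q by lra.
pose eta := c * Q `^ (- t).
have eta0 : 0 < eta by rewrite mulr_gt0 ?powR_gt0.
have rng : Q `^ (- alpha) <= eta <= Q `^ (- d%:R^-1) := Hr Q QQr.
pose m := Q * eta ^+ d.
have m0 : 0 < m by rewrite mulr_gt0 ?exprn_gt0.
exists (A_ Q eta theta), m, (Q `^ (- beta)), (eta / (2 * Q)); split.
  split => //.
  - exact: A_open.
  - by rewrite divr_gt0// mulr_gt0.
  - rewrite ler_pdivrMr ?mulr_gt0//.
    have -> : eta = c * Q `^ (- (1 + t - beta)) * (Q `^ (- beta) * Q).
      rewrite -{3}(powRr1 (ltW Qg0)) -mulrA -!powRDp//; congr (_ * _ `^ _); ring.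
    have w0 : 0 < Q `^ (- beta) * Q by rewrite mulr_gt0 ?powR_gt0.
    have h : c * Q `^ (- (1 + t - beta)) <= 1.
      by rewrite mulrC -ler_pdivlMr// mul1r; exact: Hc.
    apply: (@le_trans _ _ (1 * (Q `^ (- beta) * Q))); first by rewrite ler_pM2r.
    by clear -w0; lra.
  - exact: Hd.
have CC : C <= C + C1 by lra.
split.
- move=> x r Kx br r1; have [_ /(_ r1)] := cnt Q eta x r QQ0 rng Kx br.
  apply: le_trans; rewrite lee_fin ler_wpM2r ?powR_ge0// ler_wpM2r ?(ltW m0)//.
  by rewrite lef_pV2 ?posrE; clear -C10 Cge1; lra.
- move=> x r Kx br; have [h _] := cnt Q eta x r QQ0 rng Kx br.
  by apply: (le_trans h); rewrite lee_fin ler_wpM2r ?powR_ge0// ler_wpM2r ?(ltW m0).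
- move=> x r Kx r'r r1; have [rb|br] := leP r (Q `^ (- beta)).
    apply: (le_trans (H1 Q x r QQ1 Kx r'r rb)); rewrite lee_fin ler_wpM2r ?powR_ge0//.
    by rewrite ler_wpM2r ?(ltW m0)//; clear -C10 Cge1; lra.
  have [h _] := cnt Q eta x r QQ0 rng Kx (ltW br).
  have r0 : 0 < r by apply: lt_trans br; rewrite powR_gt0.
  apply: (le_trans h); rewrite lee_fin -/m; apply: ler_pM.
  + by rewrite mulr_ge0 ?(ltW m0)//; clear -Cge1; lra.
  + exact: powR_ge0.
  + by rewrite ler_wpM2r ?(ltW m0).
  + by apply: powR_dec; rewrite ?(ltW r0)// ltW.
- move=> x y Ax xy.
  have [q [/andP[Qq qQ] dq]] := A_nbhs Q eta eta theta x y Qg0 Ax (ltW xy).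
  exists q; first by rewrite -(ler_nat R) (le_trans QN).
  apply: (lt_le_trans dq); have := HQ q Qq qQ; rewrite /eta; clear; lra.
Qed.

Lemma interpolated_bound mu K (delta alpha beta Q0 C t c s M : R) (theta : V) (E : R) :
  (1 <= d)%N -> compact K -> mu K = 1%E -> 0 < beta -> 0 < s -> s <= delta ->
  1 < Q0 -> regular K mu delta C -> counting_bounds K mu delta alpha beta theta Q0 C ->
  0 < c -> s * (beta * delta + M) <= beta * delta ^+ 2 -> 0 <= E ->
  forall Q x r, Q0 <= Q -> Q `^ (- alpha) <= c * Q `^ (- t) <= Q `^ (- d%:R^-1) ->
    K x -> 0 < r -> r <= Q `^ (- beta) ->
    (mu (ball x r `&` A_ Q (c * Q `^ (- t)) theta) <=
       (E * (Q * (c * Q `^ (- t)) ^+ d) * (r `^ delta * Q `^ M))%:E)%E ->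
    (mu (ball x r `&` A_ Q (c * Q `^ (- t)) theta) <=
       ((E + C) * (Q * (c * Q `^ (- t)) ^+ d) * r `^ s)%:E)%E.
Proof.
move=> d1 cK muK b0 s0 sd Q01 reg cnt c0 hs E0 Q x r QQ0 rng Kx r0 rb hM.
have [C1 _ _] := reg.
have Qg0 : 0 < Q by lra.
have Qg1 : 1 <= Q by lra.
have eta0 : 0 < c * Q `^ (- t) by rewrite mulr_gt0 ?powR_gt0.
have m0 : 0 < Q * (c * Q `^ (- t)) ^+ d by rewrite mulr_gt0 ?exprn_gt0.
have [h|h] := powR_interp Q r s delta beta M Qg1 r0 s0 sd hs.
  apply: (le_trans hM); rewrite lee_fin; apply: ler_pM => //.
  - by rewrite mulr_ge0 ?(ltW m0).
  - by rewrite mulr_ge0 ?powR_ge0.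
  - by rewrite ler_wpM2r ?(ltW m0)//; lra.
have [up _] := cnt Q _ x (Q `^ (- beta)) QQ0 rng Kx (lexx _).
apply: (@le_trans _ _ (mu (ball x (Q `^ (- beta)) `&` A_ Q (c * Q `^ (- t)) theta))).
  apply: le_mu; try exact: measurable_ballA.
  by apply: setSI; exact: le_ball.
apply: (le_trans up); rewrite lee_fin -powRrM mulNr; apply: ler_pM => //.
- by rewrite mulr_ge0 ?(ltW m0)//; lra.
- exact: powR_ge0.
- by rewrite ler_wpM2r ?(ltW m0)//; lra.
Qed.

End lower.

(** * The two mass estimates behind the lower bounds *)

Section bounds.
Context {R : realType} {d : nat}.
Local Notation V := 'rV[R]_d.
Implicit Types (mu : probability (borel_rV R d) R) (K S : set V).

Lemma approximation_massE (Q c t : R) : 0 < Q -> 0 < c ->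
  Q * (c * Q `^ (- t)) ^+ d = c ^+ d * Q `^ (1 - t * d%:R).
Proof.
move=> Q0 c0; rewrite exprMn -(powR_mulrn d (powR_ge0 Q (- t))) -powRrM.
by rewrite mulrCA -{1}(powRr1 (ltW Q0)) -powRDp//; congr (_ * _ `^ _); ring.
Qed.

(** The approximation set is simply discarded, leaving [C * r ^ delta]; relative to [Q * eta ^ d],
    which is [c ^ d * Q ^ (1 - t * d)], this loses [Q ^ (t * d - 1)]. *)
Lemma hausdorff_W_infty_general mu K (psi : nat -> R) (delta alpha beta Q0 C t c s : R)
  (theta : V) :
  (1 <= d)%N -> compact K -> mu K = 1%E -> 0 < beta -> beta < 1 -> 0 < s -> s < delta ->
  1 < Q0 -> regular K mu delta C -> counting_bounds K mu delta alpha beta theta Q0 C ->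
  d%:R^-1 < t -> t < alpha -> 0 < c ->
  (forall B : R, exists2 Q : R, B <= Q &
    forall q : nat, Q <= q%:R -> q%:R < 2 * Q -> 2 * c * Q `^ (- t) <= psi q) ->
  s * (beta * delta + (t * d%:R - 1)) <= beta * delta ^+ 2 ->
  hausdorff_measure s (K `&` W psi theta) = +oo%E.
Proof.
move=> d1 cK muK b0 b1 s0 sd Q01 reg cnt dt ta c0 Hpsi hs.
have [C1 upb _] := reg.
have cd0 : 0 < c ^+ d by rewrite exprn_gt0.
have E0 : 0 < C / c ^+ d by rewrite divr_gt0//; lra.
apply: (@hausdorff_W_infty R d mu K psi delta alpha beta Q0 C t c s theta) => //.
have [Q1 Q11 rng] := eventually_range alpha t c dt ta c0.
exists (Num.max Q0 Q1), (C / c ^+ d + C); split; first by lra.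
move=> Q x r; rewrite ge_max => /andP[QQ0 QQ1] Kx r'r rb.
have Qg0 : 0 < Q by lra.
have r0 : 0 < r.
  by apply: lt_le_trans r'r; rewrite divr_gt0 ?mulr_gt0 ?powR_gt0.
apply: (@interpolated_bound R d mu K delta alpha beta Q0 C t c s (t * d%:R - 1) theta
  (C / c ^+ d) d1 cK muK b0 s0 (ltW sd) Q01 reg cnt c0 hs (ltW E0) Q x r QQ0
    (rng Q QQ1) Kx r0 rb).
apply: (@le_trans _ _ (mu (ball x r))).
  by apply: le_mu; [exact: measurable_ballA|exact: measurable_ball_rV|exact: subIsetl].
apply: (le_trans (upb x r Kx r0)); rewrite lee_fin approximation_massE//.
rewrite (_ : C / c ^+ d * _ * _ = C * r `^ delta *
    (Q `^ (1 - t * d%:R) * Q `^ (t * d%:R - 1))); last by field; rewrite gt_eqF.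
by rewrite -powRDp// (_ : 1 - _ + _ = 0) ?powRr0 ?mulr1//; ring.
Qed.

(** Radii go down to [eta / (2 * Q)]; doubling the radius restores the condition
    [eta <= Q * (2 * rho)] of [slab_measure] at the price of a constant. *)
Lemma small_ball_measure mu K (delta C c t : R) :
  (1 <= d)%N -> compact K -> mu K = 1%E -> regular K mu delta C -> 0 < delta ->
  d%:R^-1 < t -> 0 < c ->
  exists Q1 G : R, 0 < G /\ forall Q (y : V) rho, Q1 <= Q ->
    c * Q `^ (- t) / (2 * Q) <= rho ->
    2 * rho <= (30 * d%:R)^-1 * Q `^ (- (1 + d%:R^-1)) ->
    (mu (ball y rho `&` A_ Q (c * Q `^ (- t)) 0) <=
      (G * (rho `^ (d%:R - 1) * (c * Q `^ (- (1 + t))) `^ (delta - (d%:R - 1))))%:E)%E.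
Proof.
move=> d1 cK muK reg delta0 dt c0.
have [C1 _ _] := reg.
have d0 : 0 < d%:R :> R by rewrite ltr0n.
have d1R : 1 <= d%:R :> R by rewrite ler1n.
have dV0 : 0 < d%:R^-1 :> R by rewrite invr_gt0.
have t1 : 0 < 1 + t by lra.
have y0 : 0 < (2 * d%:R * c)^-1 by rewrite invr_gt0 !mulr_gt0.
have [Q1 Q11 HQ1] := powR_eventually_small (1 + t) (2 * d%:R * c)^-1 t1 y0.
exists Q1, (6 `^ (d%:R - 1) * (C * (4 * d%:R) `^ delta)); split.
  by rewrite !mulr_gt0 ?powR_gt0 ?mulr_gt0//; lra.
move=> Q y rho QQ1 hr hr2.
have Qg1 : 1 <= Q by lra.
have Qg0 : 0 < Q by lra.
have eta0 : 0 < c * Q `^ (- t) by rewrite mulr_gt0 ?powR_gt0.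
have eE : c * Q `^ (- t) / Q = c * Q `^ (- (1 + t)).
  rewrite -mulrA; congr (_ * _).
  by rewrite -{2}(powRr1 (ltW Qg0)) -powRN -powRDp//; congr (_ `^ _); ring.
have etaQ : c * Q `^ (- t) <= Q * (2 * rho).
  by move: hr; rewrite ler_pdivrMr ?mulr_gt0//; lra.
have eQ : 2 * d%:R * (c * Q `^ (- t) / Q) <= 1.
  by rewrite eE mulrA mulrC -ler_pdivlMr ?mulr_gt0// mul1r; exact: HQ1.
have rho0 : 0 < rho by apply: lt_le_trans hr; rewrite divr_gt0// mulr_gt0.
have := @slab_measure R d mu K delta C Q (c * Q `^ (- t)) (2 * rho) y
  d1 cK muK reg delta0 Qg1 eta0 etaQ eQ hr2.
move=> hslab; apply: (@le_trans _ _ (mu (ball y (2 * rho) `&` A_ Q (c * Q `^ (- t)) 0))).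
  apply: le_mu; try exact: measurable_ballA.
  by apply: setSI; apply: le_ball; lra.
apply: (le_trans hslab); rewrite lee_fin eE.
set e := c * Q `^ (- (1 + t)).
have e0 : 0 < e by rewrite mulr_gt0 ?powR_gt0.
clearbody e.
have dE : d.-1%:R = d%:R - 1 :> R.
  by rewrite -[in RHS](prednK d1) -natr1 addrK.
rewrite -powR_mulrn ?dE; last by rewrite !mulr_ge0 ?invr_ge0 ?(ltW rho0) ?(ltW e0).
rewrite (_ : 3 * (2 * rho / e) = 6 * (rho * e^-1)); last by ring.
rewrite !powRM ?mulr_ge0 ?invr_ge0 ?(ltW rho0) ?(ltW e0) ?(ltW d0)//.
rewrite powR_inv ?(ltW e0)// -powRN.
rewrite (_ : e `^ (delta - _) = e `^ (- (d%:R - 1)) * e `^ delta); last first.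
  by rewrite -powRDp//; congr (_ `^ _); ring.
rewrite le_eqVlt; apply/orP; left; apply/eqP; ring.
Qed.

(* At scales [r >= rho ~ Q `^ (- (1 + 1 / d))] the ball is first covered by
   [(r / rho) `^ delta] balls of radius [rho], which produces the exponent
   [(t - 1 / d) * (2 * d - delta - 1)].  Below [rho] the hyperplane bound suffices,
   because the hypothesis on [t] says [d - 1 <= kappa]. *)
Lemma hausdorff_W_infty_hyperplane mu K (psi : nat -> R) (delta alpha beta Q0 C t c s : R) :
  (1 <= d)%N -> compact K -> mu K = 1%E -> 0 < beta -> beta < 1 -> 0 < s -> s < delta ->
  1 < Q0 -> regular K mu delta C -> counting_bounds K mu delta alpha beta 0 Q0 C ->
  d%:R^-1 < t -> t < alpha -> 0 < c ->
  (forall B : R, exists2 Q : R, B <= Q &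
    forall q : nat, Q <= q%:R -> q%:R < 2 * Q -> 2 * c * Q `^ (- t) <= psi q) ->
  d%:R - 1 < delta -> t * (2 * d%:R - delta - 1) <= delta + 2 - d%:R ->
  s * (beta * delta + (t - d%:R^-1) * (2 * d%:R - delta - 1)) <= beta * delta ^+ 2 ->
  s <= delta + (1 + d%:R) / (1 + t) - d%:R ->
  hausdorff_measure s (K `&` W psi 0) = +oo%E.
Proof.
move=> d1 cK muK b0 b1 s0 sd Q01 reg cnt dt ta c0 Hpsi ddelta htau hs sk.
have delta0 : 0 < delta by lra.
have [C1 _ _] := reg.
have d0 : 0 < d%:R :> R by rewrite ltr0n.
have dV0 : 0 < d%:R^-1 :> R by rewrite invr_gt0.
have t1 : 0 < 1 + t by lra.
set kappa := delta + _ - _ in sk.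
have kE : kappa * (1 + t) = 1 + delta - t * (d%:R - delta).
  by rewrite /kappa; field; rewrite gt_eqF.
have kd : d%:R - 1 <= kappa.
  by rewrite -(ler_pM2r t1) kE; lra.
have cd0 : 0 < c ^+ d by rewrite exprn_gt0.
pose M := (t - d%:R^-1) * (2 * d%:R - delta - 1); rewrite -/M in hs.
pose a := delta - (d%:R - 1).
(* Twice the constant of the hyperplane bound, because [small_ball_measure] works in balls of radius
   [2 * rho]. *)
pose D : R := 2 * (30 * d%:R).
have D0 : 0 < D by rewrite !mulr_gt0.
have [Qs [G [G0 small]]] := @small_ball_measure mu K delta C c t d1 cK muK reg delta0 dt c0.
have [Qr Qr1 rng] := eventually_range alpha t c dt ta c0.
have td0 : 0 < t - d%:R^-1 by lra.
have y0 : 0 < (c * D)^-1 by rewrite invr_gt0 mulr_gt0.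
have [Qt Qt1 Ht] := powR_eventually_small (t - d%:R^-1) (c * D)^-1 td0 y0.
pose E1 := G * (c `^ (delta - kappa) / c ^+ d * 2 `^ (kappa - (d%:R - 1))).
pose E2 := C ^+ 2 * 4 `^ delta * G * (D `^ a * (c `^ a / c ^+ d)).
have E10 : 0 < E1 by rewrite /E1 !(mulr_gt0, invr_gt0, powR_gt0, exprn_gt0).
have E20 : 0 < E2.
  by rewrite /E2 !(mulr_gt0, invr_gt0, powR_gt0, exprn_gt0)//; clear -C1; lra.
apply: (@hausdorff_W_infty R d mu K psi delta alpha beta Q0 C t c s 0) => //.
exists (Num.max (Num.max Q0 Qs) (Num.max Qr Qt)), (E1 + (E2 + C)); split;
  first by clear -E10 E20 C1; lra.
move=> Q x r; rewrite !ge_max => /andP[/andP[QQ0 QQs] /andP[QQr QQt]] Kx r'r rb.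
have Qg0 : 0 < Q by exact: lt_le_trans (lt_trans ltr01 Q01) QQ0.
have Qg1 : 1 <= Q by exact: le_trans (ltW Q01) QQ0.
have r0 : 0 < r.
  by apply: lt_le_trans r'r; rewrite divr_gt0 ?mulr_gt0 ?powR_gt0.
have r1 : r <= 1.
  by apply: (le_trans rb); rewrite -(powRr0 Q) ler_powR//; clear -b0; lra.
set eta := c * Q `^ (- t); set e := c * Q `^ (- (1 + t)).
have eta0 : 0 < eta by rewrite mulr_gt0 ?powR_gt0.
have e0 : 0 < e by rewrite mulr_gt0 ?powR_gt0.
have eE : eta / (2 * Q) = e / 2.
  rewrite /eta /e -(_ : c * Q `^ (- t) / Q = c * Q `^ (- (1 + t))); last first.
    rewrite -mulrA; congr (_ * _).
    by rewrite -{2}(powRr1 (ltW Qg0)) -powRN -powRDp//; congr (_ `^ _); ring.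
  by field; rewrite gt_eqF.
have m0 : 0 < Q * eta ^+ d by rewrite mulr_gt0 ?exprn_gt0.
pose rho := D^-1 * Q `^ (- (1 + d%:R^-1)).
have rho0 : 0 < rho by rewrite mulr_gt0 ?invr_gt0 ?powR_gt0.
have rhoE : 2 * rho = (30 * d%:R)^-1 * Q `^ (- (1 + d%:R^-1)).
  by rewrite /rho /D; field; rewrite gt_eqF.
have [rrho|rrho] := leP r rho.
  have r2 : 2 * r <= (30 * d%:R)^-1 * Q `^ (- (1 + d%:R^-1)) by rewrite -rhoE ler_pM2l.
  apply: (le_trans (small Q x r QQs r'r r2)); rewrite lee_fin -/e -/a.
  apply: (@le_trans _ _ (E1 * (Q * eta ^+ d) * r `^ s)); last first.
    rewrite ler_wpM2r ?powR_ge0// ler_wpM2r ?(ltW m0)//; clear -E20 C1; lra.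
  (* By the choice of [kappa], [(1 + t) * (delta - kappa) = t * d - 1], so [e ^ (delta - kappa)] is
     [Q * eta ^ d] up to a constant. *)
  have -> : e `^ a = (Q * eta ^+ d) * (c `^ (delta - kappa) / c ^+ d) * e `^ (kappa -
    (d%:R - 1)).
    have -> : e `^ a = e `^ (delta - kappa) * e `^ (kappa - (d%:R - 1)).
      by rewrite -powRDp//; congr (_ `^ _); rewrite /a; ring.
    congr (_ * _); rewrite approximation_massE// /e powRM ?(ltW c0) ?powR_ge0// -powRrM.
    rewrite (_ : - (1 + t) * (delta - kappa) = 1 - t * d%:R); last first.
      by rewrite mulrBr; move: kE; clear; lra.
    by field; rewrite gt_eqF.
  have ek : e `^ (kappa - (d%:R - 1)) <= 2 `^ (kappa - (d%:R - 1)) * r `^ (kappa - (d%:R - 1)).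
    rewrite -powRM ?(ltW r0)//; apply: ge0_ler_powR; rewrite ?nnegrE ?(ltW e0)//;
      first by rewrite subr_ge0.
      by rewrite mulr_ge0// ltW.
    by move: r'r; rewrite -/eta eE; clear; lra.
  have rk : r `^ (d%:R - 1) * r `^ (kappa - (d%:R - 1)) <= r `^ s.
    rewrite -powRDp// (_ : _ + _ = kappa); last by ring.
    by apply: powR_dec; rewrite ?(ltW r0)// ltW.
  have F0 : 0 <= c `^ (delta - kappa) / c ^+ d by rewrite divr_ge0 ?powR_ge0// ltW.
  move: (Q * eta ^+ d) m0 ek rk F0 => m m0.
  rewrite /E1; move: (c `^ (delta - kappa) / c ^+ d) => F.
  set ek := e `^ _; set rk := r `^ (kappa - _); set rn := r `^ (d%:R - 1); set two := 2 `^ _.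
  move=> h1 h2 F0.
  have GFm : 0 <= G * F * m by rewrite !mulr_ge0// ltW.
  apply: (@le_trans _ _ (G * F * m * (rn * (two * rk)))).
    rewrite (_ : G * _ = G * F * m * (rn * ek)); last by ring.
    by rewrite ler_wpM2l// ler_wpM2l// powR_ge0.
  rewrite (_ : G * (F * two) * m * _ = G * F * m * (two * r `^ s)); last by ring.
  by rewrite ler_wpM2l// mulrCA ler_wpM2l// powR_ge0.
have bnd y : K y -> (mu (ball y rho `&` A_ Q eta 0) <=
    (G * (rho `^ (d%:R - 1) * e `^ a))%:E)%E.
  move=> Ky; apply: small => //; last by rewrite rhoE.
  rewrite eE /e /rho.
  have -> : Q `^ (- (1 + t)) = Q `^ (- (t - d%:R^-1)) * Q `^ (- (1 + d%:R^-1)).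
    by rewrite -powRDp//; congr (_ `^ _); ring.
  have := Ht _ QQt; set w := Q `^ (- (t - _)) => hw.
  set w' := Q `^ _; have w'0 : 0 < w' by rewrite powR_gt0.
  have w0 : 0 < w by rewrite powR_gt0.
  have cw : c * w <= D^-1.
    move: hw; rewrite invfM ler_pdivlMl//.
  rewrite mulrA; apply: (@le_trans _ _ (c * w * w')); last by rewrite ler_pM2r.
  by rewrite ler_pdivrMr// ler_peMr ?mulr_ge0 ?(ltW w'0) ?(ltW w0) ?(ltW c0)//; clear; lra.
have rho1 : rho <= 1 := le_trans (ltW rrho) r1.
apply: (@le_trans _ _ (((E2 + C) * (Q * eta ^+ d) * r `^ s))%:E); last first.
  rewrite lee_fin ler_wpM2r ?powR_ge0// ler_wpM2r ?(ltW m0)//; clear -E10; lra.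
apply: (@interpolated_bound R d mu K delta alpha beta Q0 C t c s M 0 E2 d1 cK muK b0 s0
   (ltW sd) Q01 reg cnt c0 hs (ltW E20) Q x r QQ0 (rng Q QQr) Kx r0 rb).
have mA : measurable (A_ Q eta 0 : set (borel_rV R d)).
  by apply: open_measurable_rV; exact: A_open.
have := @ball_cover_measure R d mu K (A_ Q eta 0) delta C r rho _ x cK muK reg delta0 Kx mA
  rho0 rho1 (ltW rrho) bnd.
move/le_trans; apply; rewrite lee_fin -/eta approximation_massE//.
have -> : (r / rho) `^ delta = r `^ delta * rho `^ (- delta).
  by rewrite powRM ?invr_ge0 ?(ltW rho0) ?(ltW r0)// powR_inv ?(ltW rho0)// powRN.
have rhoa : rho `^ (- delta) * rho `^ (d%:R - 1) = D `^ a * Q `^ ((1 + d%:R^-1) * a).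
  rewrite -powRDp// (_ : - delta + _ = - a); last by rewrite /a; ring.
  rewrite /rho powRM ?invr_ge0 ?(ltW D0) ?powR_ge0// powR_inv ?(ltW D0)// powRN invrK.
  by rewrite -powRrM mulrNN.
have ea : e `^ a = c `^ a * Q `^ (- (1 + t) * a).
  by rewrite /e powRM ?(ltW c0) ?powR_ge0// -powRrM.
have rearr (x1 x2 x3 x4 x5 x6 x7 : R) :
    x1 * x2 * (x3 * x4) * (x5 * (x6 * x7)) = x1 * x2 * x5 * x3 * (x4 * x6 * x7).
  by clear; ring.
rewrite rearr rhoa ea.
(* Both exponents are [- (t - 1 / d) * a]: out of [t * d - 1 = (t - 1 / d) * d] the hyperplane
   recovers [(t - 1 / d) * a], and [M = (t - 1 / d) * (d - a)] remains. *)
have QE : Q `^ ((1 + d%:R^-1) * a) * Q `^ (- (1 + t) * a) =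
   Q `^ (1 - t * d%:R) * Q `^ M.
  rewrite -!powRDp//; congr (_ `^ _); rewrite /a /M; field; rewrite gt_eqF//.
rewrite [leLHS](_ : _ = C ^+ 2 * 4 `^ delta * G * r `^ delta * D `^ a * c `^ a *
   (Q `^ ((1 + d%:R^-1) * a) * Q `^ (- (1 + t) * a))); last by ring.
rewrite QE /E2 le_eqVlt; apply/orP; left; apply/eqP.
by field; rewrite gt_eqF.
Qed.

End bounds.

(** A zero denominator gives [+oo] and a negative one a negative quotient, so the bounds of the
    theorem carry sign information; [delta <= d] is obtained this way. *)
Lemma lte_ediv_fin {R : realType} (x a b : R) : 0 < x -> 0 < a ->
  (x%:E < a%:E / b%:E)%E -> 0 <= b /\ x * b < a.
Proof.
move=> x0 a0; rewrite inver; case: eqP => [-> _|/eqP bN]; first by rewrite lexx mulr0.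
rewrite -EFinM lte_fin => h; have [b0|b0] := ltP b 0.
  have : a / b < 0 by rewrite pmulr_rlt0// invr_lt0.
  by lra.
have b0' : 0 < b by rewrite lt_neqAle eq_sym bN.
by move: h; rewrite ltr_pdivlMr.
Qed.

Lemma hausdorff_dim_ge0 {R : realType} {V : normedModType R} (A : set V) :
  (0 <= hausdorff_dim A)%E.
Proof. by apply: le_ereal_inf_tmp => _ [t [t0 _] <-]; rewrite lee_fin. Qed.

(** * Bounds for the dimension *)

Section assembly.
Context {R : realType} {d : nat}.
Local Notation V := 'rV[R]_d.
Implicit Types (mu : probability (borel_rV R d) R) (K : set V).

(** [kappa] is the zero in [s] of [t * d - 1 + (1 + t) * (s - delta)] at [t = tau]; at
    [s = kappa + e] this is positive and remains so for [t] slightly below [tau]. *)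
Lemma hausdorff_dim_W_le mu K (psi : nat -> R) (delta alpha beta Q0 C tau kappa : R)
  (theta : V) :
  (1 <= d)%N -> compact K -> 0 < beta -> 0 < delta -> 1 < Q0 ->
  regular K mu delta C -> counting_bounds K mu delta alpha beta theta Q0 C ->
  (forall q, 0 <= psi q) -> lower_order psi = tau%:E ->
  d%:R^-1 < tau -> tau < alpha ->
  kappa * (1 + tau) = 1 + delta - tau * (d%:R - delta) -> 0 <= kappa ->
  (hausdorff_dim (K `&` W psi theta) <= kappa%:E)%E.
Proof.
move=> d1 cK b0 delta0 Q01 reg cnt psi0 lo dtau taua kE' k0.
have d0 : 0 < d%:R :> R by rewrite ltr0n.
have dV0 : 0 < d%:R^-1 :> R by rewrite invr_gt0.
have t1 : 0 < 1 + tau by lra.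
have kE : tau * d%:R - 1 + (1 + tau) * (kappa - delta) = 0.
  by move: kE'; lra.
apply/lee_addgt0Pr => e e0; rewrite -EFinD.
apply: hausdorff_dim_le; first by rewrite addr_ge0// ltW.
pose s := kappa + e.
pose L := `|d%:R + s - delta| + 1.
have L0 : 0 < L by have := normr_ge0 (d%:R + s - delta); rewrite /L; lra.
(* The first entry keeps [tau - h] above [1 / d]; the second bounds the loss [h * (d + s - delta)]
   by [e / 2], below the gain [(1 + tau) * e]. *)
pose h := Num.min ((tau - d%:R^-1) / 2) (e / (2 * L)).
have h0 : 0 < h by rewrite lt_min !divr_gt0// ?mulr_gt0//; lra.
have h1 : h <= (tau - d%:R^-1) / 2 by rewrite ge_min lexx.
have h2 : h * L <= e / 2.
  have : h <= e / (2 * L) by rewrite ge_min lexx orbT.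
  by rewrite ler_pdivlMr ?mulr_gt0//; lra.
have h3 : h * (d%:R + s - delta) <= h * L.
  by rewrite ler_wpM2l ?(ltW h0)// /L; have := ler_norm (d%:R + s - delta); lra.
have te : 0 < tau * e by rewrite mulr_gt0//; lra.
have lot : ((tau - h)%:E < lower_order psi)%E by rewrite lo lte_fin; lra.
have [N HN] := lower_order_gt psi (tau - h) psi0 lot.
apply: (@hausdorff_measure_W_eq0 R d mu K psi delta alpha beta Q0 C (tau - h) (kappa + e)
   theta d1 cK b0 delta0 Q01 reg cnt) => //; try by clear -h0 h1 dtau taua dV0 k0 e0; lra.
- by exists N.
- have -> : (tau - h) * d%:R - 1 + (1 + (tau - h)) * (kappa + e - delta) =
    (tau * d%:R - 1 + (1 + tau) * (kappa - delta)) + ((1 + tau) * e - h * (d%:R + s - delta)).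
    by rewrite /s; ring.
  by rewrite kE; lra.
Qed.

(* The strict inequality at [tau] survives at some [t > tau]. *)
Lemma hausdorff_dim_W_ge mu K (psi : nat -> R) (delta alpha beta Q0 C tau kappa : R)
  (theta : V) :
  (1 <= d)%N -> compact K -> mu K = 1%E -> 0 < beta -> beta < 1 -> 0 < delta -> 1 < Q0 ->
  regular K mu delta C -> counting_bounds K mu delta alpha beta theta Q0 C ->
  (forall q, 0 <= psi q) -> nonincreasing_seq psi \/ nondecreasing_seq psi ->
  lower_order psi = tau%:E -> d%:R^-1 < tau -> tau < alpha ->
  ((Num.min (delta - (tau * d%:R - 1) * kappa / (beta * delta)) kappa)%:E
     <= hausdorff_dim (K `&` W psi theta))%E.
Proof.
move=> d1 cK muK b0 b1 delta0 Q01 reg cnt psi0 mono lo dtau taua.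
set sp := Num.min _ _.
have d0 : 0 < d%:R :> R by rewrite ltr0n.
have dV0 : 0 < d%:R^-1 :> R by rewrite invr_gt0.
have td0 : 0 < tau * d%:R - 1 by rewrite subr_gt0 -ltr_pdivrMr// mul1r.
have bd0 : 0 < beta * delta by rewrite mulr_gt0.
have s1 : (tau * d%:R - 1) * kappa <= (delta - sp) * (beta * delta).
  rewrite -ler_pdivrMr//.
  have : sp <= delta - (tau * d%:R - 1) * kappa / (beta * delta) by rewrite ge_min lexx.
  by lra.
have s2 : sp <= kappa by rewrite ge_min lexx orbT.
clearbody sp.
apply/lee_subgt0Pr => e e0; rewrite -EFinB.
have [v0|v0] := leP (sp - e) 0.
  by apply: le_trans (hausdorff_dim_ge0 _); rewrite lee_fin.
set v := sp - e in v0 *.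
(* Since [v <= kappa], the first entry of the minimum puts [v] strictly below the interpolation
   exponent; the gap is the room for raising [tau] to [t]. *)
have gap : 0 < beta * delta ^+ 2 - v * (beta * delta + (tau * d%:R - 1)).
  have h1 : (tau * d%:R - 1) * v <= (tau * d%:R - 1) * kappa.
    by rewrite ler_wpM2l ?(ltW td0)// /v; lra.
  have h2 : 0 < e * (beta * delta) by rewrite mulr_gt0.
  have -> : beta * delta ^+ 2 - v * (beta * delta + (tau * d%:R - 1)) =
    ((delta - sp) * (beta * delta) - (tau * d%:R - 1) * v) + e * (beta * delta).
    by rewrite /v; ring.
  by lra.
clearbody v.
set g := (X in 0 < X) in gap.
have vd0 : 0 < v * d%:R by rewrite mulr_gt0.
pose h := Num.min ((alpha - tau) / 2) (g / (v * d%:R)).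
have h0 : 0 < h by rewrite lt_min !divr_gt0//; lra.
have h1 : h <= (alpha - tau) / 2 by rewrite ge_min lexx.
have h2 : h * (v * d%:R) <= g by rewrite -ler_pdivlMr// ge_min lexx orbT.
pose t := tau + h.
have ta : t < alpha by rewrite /t; lra.
have dt : d%:R^-1 < t by rewrite /t; lra.
have t0 : 0 < t by lra.
have hv : v * (beta * delta + (t * d%:R - 1)) <= beta * delta ^+ 2.
  by move: h2; rewrite /g /t; lra.
have vd : v < delta.
  have td1 : 0 < t * d%:R - 1 by rewrite subr_gt0 -ltr_pdivrMr// mul1r.
  have : 0 < v * (t * d%:R - 1) by rewrite mulr_gt0.
  by move=> h4; rewrite -(ltr_pM2r bd0); lra.
have lot : (lower_order psi < t%:E)%E by rewrite lo lte_fin /t; lra.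
have [|c' c'0 Hc] := @monotone_large R psi t 1 mono t0 ltr01.
  move=> N; have [q Nq hq] := lower_order_lt psi t psi0 lot N.
  by exists q => //; rewrite mul1r ltW.
apply: hausdorff_dim_ge.
have c20 : 0 < c' / 2 by rewrite divr_gt0.
apply: (@hausdorff_W_infty_general R d mu K psi delta alpha beta Q0 C t
  (c' / 2) v theta) => //.
by move=> B; have [Q BQ HQ] := Hc B; exists Q => // q;
  rewrite [2 * (c' / 2)]mulrC divfK//; exact: HQ.
Qed.

Lemma hausdorff_measure_W0_infty mu K (psi : nat -> R) (delta alpha beta Q0 C c tau : R) :
  (1 <= d)%N -> compact K -> mu K = 1%E -> 0 < beta -> beta < 1 -> 1 < Q0 ->
  regular K mu delta C -> counting_bounds K mu delta alpha beta 0 Q0 C ->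
  nonincreasing_seq psi \/ nondecreasing_seq psi ->
  d%:R - 1 < delta -> delta <= d%:R -> 0 < c -> d%:R^-1 < tau -> tau < alpha ->
  tau * (2 * d%:R - delta - 1) < delta + 2 - d%:R ->
  infinite_set [set q : nat | c * q%:R `^ (- tau) <= psi q] ->
  let kappa := delta + (1 + d%:R) / (1 + tau) - d%:R in
  let s := Num.min
    (delta - (tau - d%:R^-1) * (2 * d%:R - delta - 1) * kappa / (beta * delta)) kappa in
  hausdorff_measure s (K `&` W psi 0) = +oo%E.
Proof.
move=> d1 cK muK b0 b1 Q01 reg cnt mono ddelta deltad c0 dtau taua htau inf kappa s.
have d0 : 0 < d%:R :> R by rewrite ltr0n.
have d1R : 1 <= d%:R :> R by rewrite ler1n.
have dV0 : 0 < d%:R^-1 :> R by rewrite invr_gt0.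
have delta0 : 0 < delta by lra.
have t0 : 0 < tau by lra.
have t1 : 0 < 1 + tau by lra.
have bd0 : 0 < beta * delta by rewrite mulr_gt0.
have kE : kappa * (1 + tau) = 1 + delta - tau * (d%:R - delta).
  by rewrite /kappa; field; rewrite gt_eqF.
have kd : d%:R - 1 < kappa by rewrite -(ltr_pM2r t1) kE; lra.
have k0 : 0 < kappa by lra.
have kdelta : kappa < delta.
  rewrite -(ltr_pM2r t1) kE.
  have : 0 < tau * d%:R - 1 by rewrite subr_gt0 -ltr_pdivrMr// mul1r.
  by lra.
pose M := (tau - d%:R^-1) * (2 * d%:R - delta - 1).
have M0 : 0 <= M by apply: mulr_ge0; lra.
have s1 : M * kappa <= (delta - s) * (beta * delta).
  rewrite -ler_pdivrMr//.
  have : s <= delta - (tau - d%:R^-1) * (2 * d%:R - delta - 1) * kappa / (beta * delta).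
    by rewrite /s ge_min lexx.
  by rewrite -/M; lra.
have s2 : s <= kappa by rewrite /s ge_min lexx orbT.
have hpsi : forall N, exists2 q, (N <= q)%N & c * q%:R `^ (- tau) <= psi q.
  by apply/infinite_nat_unbounded.
have [c' c'0 Hc] := @monotone_large R psi tau c mono t0 c0 hpsi.
have c20 : 0 < c' / 2 by rewrite divr_gt0.
have main s' : 0 < s' -> s' <= kappa ->
    s' * (beta * delta + M) <= beta * delta ^+ 2 ->
    hausdorff_measure s' (K `&` W psi 0) = +oo%E.
  move=> s'0 s'k s'M.
  apply: (@hausdorff_W_infty_hyperplane R d mu K psi delta alpha beta Q0 C tau
    (c' / 2) s') => //.
  - by lra.
  - by move=> B; have [Q BQ HQ] := Hc B; exists Q => // q;
    rewrite [2 * (c' / 2)]mulrC divfK//; exact: HQ.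
  - exact: ltW.
(* The descent needs a positive exponent. If [s <= 0], infinite measure at some positive [s'] is
   carried down to [s] by monotonicity. *)
have [s0|s0] := ltP 0 s.
  apply: main => //.
  have : M * s <= M * kappa by rewrite ler_wpM2l.
  by lra.
have bM0 : 0 < beta * delta + M by lra.
pose s' := Num.min (beta * delta ^+ 2 / (beta * delta + M)) kappa.
have s'0 : 0 < s' by rewrite lt_min k0 andbT divr_gt0// mulr_gt0// exprn_gt0.
apply/eqP; rewrite -leye_eq -(main s') //.
- by apply: hausdorff_measure_mono => //; lra.
- by rewrite ge_min lexx orbT.
- by rewrite -ler_pdivlMr// ge_min lexx.
Qed.

End assembly.

Theorem theorem1p3 (R : realType) (d : nat) (K : set 'rV[R]_d)
    (mu : probability (borel_rV R d) R) (delta alpha beta : R)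
    (theta : 'rV[R]_d) (psi : nat -> R) :
  (1 <= d)%N ->
  compact K ->
  mu K = 1%E ->
  0 < delta ->
  ahlfors_regular K mu delta ->
  0 < beta < 1 ->
  d%:R^-1 < alpha ->
  (* in the extended reals, so the bound is +oo when delta = d *)
  (alpha%:E < (1 + delta - beta * delta)%:E / (d%:R - delta)%:E)%E ->
  local_counting mu alpha beta theta ->
  (forall q, 0 <= psi q) ->
  nonincreasing_seq psi \/ nondecreasing_seq psi ->
  (((d%:R^-1)%:E < lower_order psi < alpha%:E)%E ->
   let tau := fine (lower_order psi) in
   let kappa := delta + (d%:R + 1) / (1 + tau) - d%:R in
   (hausdorff_dim (K `&` W psi theta) <= kappa%:E)%E /\
   ((Num.min (delta - (tau * d%:R - 1) * kappa / (beta * delta)) kappa)%:E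
     <= hausdorff_dim (K `&` W psi theta))%E) /\
  (d%:R - 1 < delta -> theta = 0 ->
   forall c tau : R, 0 < c ->
   d%:R^-1 < tau ->
   (* +oo as the second bound when d = delta = 1 *)
   (tau%:E < Order.min alpha%:E
               ((delta + 2 - d%:R)%:E / (2 * d%:R - delta - 1)%:E))%E ->
   infinite_set [set q : nat | c * q%:R `^ (- tau) <= psi q] ->
   let kappa := delta + (1 + d%:R) / (1 + tau) - d%:R in
   let s := Num.min
     (delta - (tau - d%:R^-1) * (2 * d%:R - delta - 1) * kappa / (beta * delta))
     kappa in
   hausdorff_measure s (K `&` W psi 0) = +oo%E /\
   (s%:E <= hausdorff_dim (K `&` W psi 0))%E).
Proof.
move=> d1 cK muK delta0 ahl /andP[b0 b1] da aub lc psi0 mono.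
have d0 : 0 < d%:R :> R by rewrite ltr0n.
have dV0 : 0 < d%:R^-1 :> R by rewrite invr_gt0.
have bdelta : beta * delta < delta by rewrite gtr_pMl.
have bdelta0 : 0 < beta * delta by rewrite mulr_gt0.
have [dd ad] : 0 <= d%:R - delta /\ alpha * (d%:R - delta) < 1 + delta - beta * delta.
  by apply: lte_ediv_fin => //; lra.
have [Q0 [C [Q01 reg cnt]]] :=
  local_counting_regular K mu delta alpha beta theta d1 cK muK delta0 ahl b0 da lc.
split.
  move=> /andP[lo1 lo2] tau kappa.
  have lo : lower_order psi = tau%:E.
    rewrite /tau fineK// fin_numE; apply/andP; split.
      by rewrite gt_eqF// (lt_trans _ lo1)// ltNyr.
    by rewrite lt_eqF// (lt_trans lo2)// ltry.
  move: lo1 lo2; rewrite lo !lte_fin => dtau taua.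
  have t1 : 0 < 1 + tau by lra.
  have kE : kappa * (1 + tau) = 1 + delta - tau * (d%:R - delta).
    by rewrite /kappa; field; rewrite gt_eqF.
  (* The bound on [alpha] yields [kappa * (1 + tau) > beta * delta]. The sign matters because the
     dimension is an infimum over [s >= 0]. *)
  have k0 : 0 <= kappa.
    rewrite -(pmulr_lge0 _ t1) kE.
    have : tau * (d%:R - delta) <= alpha * (d%:R - delta) by rewrite ler_wpM2r// ltW.
    by lra.
  split.
    exact: (@hausdorff_dim_W_le R d mu K psi delta alpha beta Q0 C tau kappa theta).
  exact: (@hausdorff_dim_W_ge R d mu K psi delta alpha beta Q0 C tau kappa theta).
move=> ddelta th0 c tau c0 dtau taum inf kappa s.
rewrite th0 in cnt.
move: taum; rewrite lt_min => /andP[taua taub].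
rewrite lte_fin in taua.
have tau0 : 0 < tau by lra.
have num0 : 0 < delta + 2 - d%:R by lra.
have [_ htau] := lte_ediv_fin tau _ _ tau0 num0 taub.
have deltad : delta <= d%:R by lra.
have H := @hausdorff_measure_W0_infty R d mu K psi delta alpha beta Q0 C c tau d1 cK muK
  b0 b1 Q01
  reg cnt mono ddelta deltad c0 dtau taua htau inf.
split; first exact: H.
by apply: hausdorff_dim_ge; exact: H.
Qed.
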